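(* The irreducible factorization is locally Lipschitz continuous on a factorization manifold: for any factorization structure $\mathfrak{M}$ and any polynomial $f\in\mathscr{F}^{\mathfrak{M}}$ with an irreducible squarefree factorization $\alpha f_1^{k_1}\cdots f_r^{k_r}$, there are constants $\delta,\eta>0$ such that, for every polynomial $g\in\mathscr{F}^{\mathfrak{M}}$ satisfying $\|f-g\|<\delta$, the irreducible squarefree factorization $\beta g_1^{k_1}\cdots g_r^{k_r}$ of $g$ satisfies $$\mathrm{dist}\big(\alpha f_1^{k_1}\cdots f_r^{k_r},\ \beta g_1^{k_1}\cdots g_r^{k_r}\big)\le\eta\,\|f-g\|.$$
   Context: For nonzero $f\in\mathbb{C}[x_1,\ldots,x_\ell]$, $\deg(f)=(\deg_{x_1}f,\ldots,\deg_{x_\ell}f)$. $\mathscr{P}^{\mathbf{n}}$ is the set of polynomials of degree exactly $\mathbf{n}$; $[\![f]\!]$ is the coefficient vector of $f$ in the monomial basis and $\|f\|=\|[\![f]\!]\|_2$. The dot product is $u\cdot v=u^{\mathsf H}v$. If $f$ has degree $\mathbf{m}$ and $f=\alpha f_1^{k_1}\cdots f_r^{k_r}$ with $\alpha\in\mathbb{C}\setminus\{0\}$, $f_j$ irreducible and pairwise coprime, $k_j\ge1$, $\mathbf{m}_j=\deg(f_j)$ (an irreducible squarefree factorization), then the factorization structure of $f$ is the formal product $\mathfrak{M}=\mathbf{m}_1^{k_1}\cdots\mathbf{m}_r^{k_r}$ (order irrelevant). The factorization manifold $\mathscr{F}^{\mathfrak{M}}$ is the set of all $f\in\mathscr{P}^{\mathbf{m}}$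 of the form $\alpha g_1^{k_1}\cdots g_r^{k_r}$ with $\alpha\in\mathbb{C}$ and $g_j\in\mathscr{P}^{\mathbf{m}_j}$ irreducible and pairwise coprime. A factorization $\alpha f_1\cdots f_k$ is a formal product with $\alpha\ne0$ and $f_j$ nonconstant; $\alpha f_1^{k_1}\cdots f_r^{k_r}$ means each $f_j$ is repeated $k_j$ times. $\mathrm{dist}(\alpha f_1\cdots f_k,\gamma g_1\cdots g_m)=1$ if $m\ne k$, and $=\min_\sigma\max_j\sin(f_j,g_{\sigma_j})$ (minimum over permutations $\sigma$ of $\{1,\ldots,k\}$) if $m=k$, where for nonzero $p,q$, $\sin(p,q)=\Big\|\frac{p}{\|p\|}-\frac{[\![q]\!]\cdot[\![p]\!]}{\|q\|\|p\|}\frac{q}{\|q\|}\Big\|$. *)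

(* Defs.v *)
From HB Require Import structures.
From mathcomp Require Import all_boot all_order all_fingroup all_algebra.
From mathcomp Require Import reals complex mpoly.

Set Implicit Arguments.
Unset Strict Implicit.
Unset Printing Implicit Defensive.

Import Order.TTheory GRing.Theory Num.Theory.

Local Open Scope ring_scope.
Local Open Scope complex_scope.

(* The complex numbers are R[i] for an arbitrary realType R. *)
Notation cpoly R l := (mpoly l (complex R)).

(* Elements of N^l are encoded as exponent vectors 'X_{1..l}; their addition
   and scaling by naturals are componentwise. *)
Notation multidegree l := (multinom l).

Section FactorizationManifold.
Variables (R : realType) (l : nat).
Implicit Types (p q d f : cpoly R l) (n : multidegree l).

(* Meaningful for p != 0 only. *)
Definition multideg p : multidegree l :=
  [multinom \max_(m <- msupp p) (m : 'X_{1..l}) i | i < l].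

Definition exact_degree n p : Prop := p != 0 /\ multideg p = n.

(* [[p]] is the family of all the coefficients of p, so that polynomials of
   different degrees are compared after padding with zeros; the sums below can
   be restricted to the support of p. *)
Definition coef_dot p q : R[i] := \sum_(m <- msupp p) (p@_m)^* * q@_m.

Definition pnorm p : R :=
  Num.sqrt (\sum_(m <- msupp p) ComplexField.Normc.normc (p@_m) ^+ 2).

Definition psin p q : R :=
  pnorm (((pnorm p)%:C)^-1 *: p
         - (coef_dot q p / (pnorm q * pnorm p)%:C) *: (((pnorm q)%:C)^-1 *: q)).

(* The units of the polynomial ring are the nonzero constants. *)
Definition irreducible p : Prop :=
  [/\ p != 0, p \isn't a GRing.unit &
      forall a b, p = a * b -> a \is a GRing.unit \/ b \is a GRing.unit].

Definition pcoprime p q : Prop :=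
  forall d a b, p = a * d -> q = b * d -> d \is a GRing.unit.

(* [:: (f_1, k_1); ...; (f_r, k_r)] encodes f_1^k_1 ... f_r^k_r. *)
Definition power_product := seq (cpoly R l * nat).

Definition expand (fs : power_product) : cpoly R l :=
  \prod_(fk <- fs) fk.1 ^+ fk.2.

Definition irreducible_coprime (fs : power_product) : Prop :=
  (forall fk, fk \in fs -> irreducible fk.1) /\
  (forall i j, (i < size fs)%N -> (j < size fs)%N -> i != j ->
     pcoprime (nth (0, 0%N) fs i).1 (nth (0, 0%N) fs j).1).

Definition irreducible_squarefree_factorization
    (f : cpoly R l) (alpha : R[i]) (fs : power_product) : Prop :=
  [/\ alpha != 0, forall fk, fk \in fs -> (0 < fk.2)%N,
      irreducible_coprime fs & f = alpha *: expand fs].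

(* The formal product m_1^k_1 ... m_r^k_r; the order is irrelevant, hence such
   sequences are only ever used up to perm_eq. *)
Definition structure := seq (multidegree l * nat).

Definition structure_of (fs : power_product) : structure :=
  [seq (multideg fk.1, fk.2) | fk <- fs].

Definition is_factorization_structure (M : structure) : Prop :=
  exists f alpha fs, irreducible_squarefree_factorization f alpha fs /\
    perm_eq (structure_of fs) M.

(* The degree of every polynomial with structure M, because the degree of a
   product of nonzero polynomials is the sum of the degrees. *)
Definition structure_degree (M : structure) : multidegree l :=
  (\sum_(mk <- M) mk.1 *+ mk.2)%MM.

(* The condition on structure_of gs says that the factors of gs have degrees
   exactly m_j (they are nonzero, being irreducible) and exponents k_j. *)
Definition factorization_manifold (M : structure) (f : cpoly R l) : Prop :=
  exact_degree (structure_degree M) f /\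
  exists (alpha : R[i]) (gs : power_product),
    [/\ perm_eq (structure_of gs) M, irreducible_coprime gs
      & f = alpha *: expand gs].

(* (alpha, [:: f_1; ...; f_k]) encodes the formal product alpha f_1 ... f_k. *)
Definition factorization : Type := (R[i] * seq (cpoly R l))%type.

Definition flat_factorization (alpha : R[i]) (fs : power_product) :
    factorization :=
  (alpha, flatten [seq nseq fk.2 fk.1 | fk <- fs]).

Definition max_sin (ps qs : seq (cpoly R l)) (s : 'S_(size ps)) : R :=
  \big[Num.max/0]_(j < size ps) psin (nth 0 ps j) (nth 0 qs (s j)).

(* The default value of the minimum is the value at the identity permutation,
   and that of the maximum is 0 as psin is nonnegative. *)
Definition dist (F G : factorization) : R :=
  if size F.2 == size G.2 then
    \big[Num.min/@max_sin F.2 G.2 1%g]_(s : 'S_(size F.2)) @max_sin F.2 G.2 s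
  else 1.

End FactorizationManifold.

(* Main.v *)
Require Import Defs.
From HB Require Import structures.
From mathcomp Require Import all_boot all_order all_fingroup all_algebra.
From mathcomp Require Import boolp classical_sets reals topology function_spaces.
From mathcomp Require Import normedtype sequences realfun.
From mathcomp Require Import ring lra complex.
From mathcomp Require Import -(notations) mpoly.
Import Order.TTheory GRing.Theory Num.Theory.
Set Implicit Arguments.
Unset Strict Implicit.
Unset Printing Implicit Defensive.
Local Open Scope ring_scope.

(** The theorem is proved by contradiction and compactness.  If no constants work
    there are polynomials g_n on the manifold that tend to f, although the
    distance between the factorizations of g_n and f exceeds n |f - g_n|.  All
    limits are taken along a nonprincipal ultrafilter on nat, along which every
    bounded sequence converges, so that no subsequences need to be extracted.

    Continuity.  By the definition of the manifold the factors G_j of g_n have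
    degrees m_j and exponents k_j that do not depend on n.  Scaled to have
    coefficient 1 at a suitable monomial mu_j, they converge to polynomials h_j,
    and f is a constant multiple of the product of the h_j^k_j
    (limit_lipschitz).  Multidegrees are additive (multidegM) and those of the
    h_j are at most m_j, hence equal to m_j.  The h_j are therefore nonconstant,
    and there are as many of them, counted with multiplicities, as irreducible
    factors of f.  As irreducible polynomials are prime (mpoly_irreducible_prime,
    by Gauss's lemma), counting forces the h_j to be irreducible, pairwise
    coprime, and equal to the factors of f up to order and constants
    (primes_matched, family_matched).

    Lipschitz bound.  If the variations G_j - h_j were infinitely larger than
    g_n - f, then dividing everything by their total size would give limits e_j,
    not all zero, such that the product of the h_j^k_j does not move at first
    order in the direction of the e_j, up to the scalar in front.  Each h_j would
    divide the corresponding e_j; as the degree of e_j is at most that of h_j, it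
    would be a constant multiple of h_j, and the constant is zero because the
    coefficient at mu_j is kept equal to 1 (factors_rigid).  So the G_j - h_j are
    bounded by a multiple of |g_n - f| (factors_lipschitz).

    The sine of two polynomials is the distance between the lines that they span
    (psin_le), hence it is bounded by |h_j - G_j| / |h_j|, and matching the
    factors accordingly bounds the distance of the two factorizations by a
    constant times |f - g_n| (dist_le_factors), a contradiction. *)

(** * Matchings of two sequences *)

Section Matching.
Implicit Types S T V : eqType.

(** Pairing the entries, rather than permuting the indices, lets matchings be
    composed without casts between permutations of different index types. *)
Definition matched S T (r : S -> T -> Prop) (s : seq S) (t : seq T) : Prop :=
  exists z : seq (S * T), [/\ perm_eq (unzip1 z) s, perm_eq (unzip2 z) t
    & forall x y, (x, y) \in z -> r x y].

Lemma perm_map_inv S T (f : S -> T) (s : seq S) (t : seq T) :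
  perm_eq (map f s) t -> exists2 s', perm_eq s' s & map f s' = t.
Proof.
have [->|[x0 _]] : s = [::] \/ exists x0, x0 \in s.
    by case: s => [|x0 s]; [left | right; exists x0; rewrite mem_head].
  by rewrite perm_sym => /perm_nilP ->; exists [::].
rewrite perm_sym => /(perm_iotaP (f x0))[js pjs ->].
exists [seq nth x0 s j | j <- js].
  apply/(perm_iotaP x0); exists js => //.
  by rewrite size_map in pjs.
rewrite -map_comp; apply/eq_in_map => j jin /=.
rewrite (nth_map x0) //; move: jin; rewrite (perm_mem pjs) mem_iota size_map.
by rewrite add0n.
Qed.

Lemma matched_size S T (r : S -> T -> Prop) s t : matched r s t -> size s = size t.
Proof. by case=> z [/perm_size <- /perm_size <- _]; rewrite !size_map. Qed.

Lemma matched_sub S T (r r' : S -> T -> Prop) s t :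
  (forall x y, x \in s -> y \in t -> r x y -> r' x y) ->
  matched r s t -> matched r' s t.
Proof.
move=> rr' [z [zs zt zr]]; exists z; split=> // x y xyz.
apply: rr' (zr _ _ xyz).
  by rewrite -(perm_mem zs); apply/mapP; exists (x, y).
by rewrite -(perm_mem zt); apply/mapP; exists (x, y).
Qed.

Lemma matched_trans S T V (r : S -> T -> Prop) (r' : T -> V -> Prop) s t v :
  matched r s t -> matched r' t v ->
  matched (fun x w => exists2 y, r x y & r' y w) s v.
Proof.
case=> z [zs zt zr] [z' [z't z'v z'r]].
have /perm_map_inv[y yz eqy] : perm_eq (unzip2 z) (unzip1 z').
  by rewrite (permPl zt) perm_sym.
have sz : size y = size z' by rewrite -(size_map snd y) eqy size_map.
exists [seq (p.1.1, p.2.2) | p <- zip y z']; split.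
- have -> : unzip1 [seq (p.1.1, p.2.2) | p <- zip y z'] = unzip1 (unzip1 (zip y z')).
    by rewrite /unzip1 -!map_comp.
  by rewrite unzip1_zip ?sz // -(permPr zs) perm_map.
- have -> : unzip2 [seq (p.1.1, p.2.2) | p <- zip y z'] = unzip2 (unzip2 (zip y z')).
    by rewrite /unzip2 -!map_comp.
  by rewrite unzip2_zip ?sz.
- move=> x w /mapP[[[a b] [c d]] abcd [-> ->]] /=.
  suff [ab cd bc] : [/\ (a, b) \in y, (c, d) \in z' & b = c].
    by exists b; [apply: zr; rewrite -(perm_mem yz) | apply: z'r; rewrite bc].
  have := abcd; move: eqy; elim: y z' {yz sz z't z'v z'r zr abcd}
    => [|[a' b'] y IH] [|[c' d'] z'] //= [eqb /IH {}IH].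
  rewrite !inE => /orP[/eqP[-> -> -> ->]|/IH[-> -> ->]].
    by rewrite !eqxx.
  by rewrite !orbT; split.
Qed.

End Matching.

(** * Divisibility in an integral domain *)

Section Divisibility.
Variable A : idomainType.
Implicit Types (a b c p q u : A) (s hs ps : seq A).

Definition divides a b : Prop := exists c, b = c * a.

Definition associated a b : Prop := exists2 u, u \is a GRing.unit & a = u * b.

(** Over a polynomial ring this unfolds to irreducible, so that a proof of one
    is a proof of the other. *)
Definition irreducible_elt p : Prop :=
  [/\ p != 0, p \isn't a GRing.unit &
      forall a b, p = a * b -> a \is a GRing.unit \/ b \is a GRing.unit].

Definition prime_elt p : Prop :=
  [/\ p != 0, p \isn't a GRing.unit &
      forall a b, divides p (a * b) -> divides p a \/ divides p b].

Definition factorial_domain : Prop :=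
  forall a, a != 0 -> exists u s,
    [/\ u \is a GRing.unit, forall p, p \in s -> prime_elt p
      & a = u * \prod_(p <- s) p].

Lemma divides_mull a b c : divides a b -> divides a (c * b).
Proof. by case=> d ->; exists (c * d); rewrite mulrA. Qed.

Lemma dividesD a b c : divides a b -> divides a c -> divides a (b + c).
Proof. by move=> [d ->] [e ->]; exists (d + e); rewrite mulrDl. Qed.

Lemma dividesB a b c : divides a b -> divides a c -> divides a (b - c).
Proof. by move=> [d ->] [e ->]; exists (d - e); rewrite mulrBl. Qed.

Lemma associated_refl a : associated a a.
Proof. by exists 1; rewrite ?unitr1 ?mul1r. Qed.

Lemma associated_sym a b : associated a b -> associated b a.
Proof. by case=> u uU ->; exists u^-1; rewrite ?unitrV ?mulKr. Qed.

Lemma associated_trans a b c : associated a b -> associated b c -> associated a c.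
Proof.
by move=> [u uU ->] [v vU ->]; exists (u * v); rewrite ?unitrM ?uU ?mulrA.
Qed.

Lemma prime_associated p q : associated q p -> prime_elt p -> prime_elt q.
Proof.
case=> u uU -> [p0 pU pP]; split.
- by rewrite mulf_neq0 //; apply: contraTneq uU => ->; rewrite unitr0.
- by rewrite unitrM uU.
- move=> a b [c abE].
  have /pP[[d ->]|[d ->]] : divides p (a * b) by exists (c * u); rewrite abE mulrA.
    by left; exists (d / u); rewrite mulrA divrK.
  by right; exists (d / u); rewrite mulrA divrK.
Qed.

Lemma prime_divides_unit p u : prime_elt p -> u \is a GRing.unit -> ~ divides p u.
Proof. by case=> _ pU _ uU [c uE]; move: uU; rewrite uE unitrM (negPf pU) andbF. Qed.

Lemma prime_divides_prod p s :
  prime_elt p -> divides p (\prod_(x <- s) x) -> exists2 x, x \in s & divides p x.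
Proof.
move=> pp; elim: s => [|x s IH].
  by rewrite big_nil => /prime_divides_unit; case=> //; rewrite unitr1.
rewrite big_cons; case: (pp) => _ _ pP /pP[px|/IH[y ys py]].
  by exists x => //; rewrite inE eqxx.
by exists y => //; rewrite inE ys orbT.
Qed.

Lemma prime_dividesX p a k : prime_elt p -> divides p (a ^+ k) -> divides p a.
Proof.
move=> pp; have -> : a ^+ k = \prod_(x <- nseq k a) x.
  by elim: k => [|k IH]; rewrite ?big_nil //= big_cons exprS IH.
by case/(prime_divides_prod pp) => x /nseqP[->].
Qed.

(** Cancel the primes one at a time: each divides some h, and the cofactor is
    either a unit, to be forgotten, or a nonunit that takes the place of h.
    In the second case the primes have become fewer than the nonunits that
    remain, so it cannot occur when the two lengths agree. *)
Lemma primes_matched ps hs u :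
  u \is a GRing.unit -> (forall p, p \in ps -> prime_elt p) ->
  (forall h, h \in hs -> h \isn't a GRing.unit) ->
  \prod_(p <- ps) p = u * \prod_(h <- hs) h ->
  (size hs <= size ps)%N /\ (size hs = size ps -> matched associated ps hs).
Proof.
elim: ps hs u => [|p ps IH] hs u uU psP hsP.
  case: hs hsP => [_ _|h hs hsP]; first by split=> // _; exists [::].
  rewrite big_nil big_cons => /esym uhE.
  have : u * (h * \prod_(j <- hs) j) \is a GRing.unit by rewrite uhE unitr1.
  by rewrite !unitrM (negPf (hsP h (mem_head _ _))) andbF.
have pp : prime_elt p by apply: psP; rewrite mem_head.
have {}psP q : q \in ps -> prime_elt q by move=> qs; apply: psP; rewrite inE qs orbT.
have [p0 _ pP] := pp.
rewrite big_cons => prodE.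
have /pP[/(prime_divides_unit pp)//|/(prime_divides_prod pp)[h hhs [w hE]]] :
  divides p (u * \prod_(h <- hs) h) by exists (\prod_(q <- ps) q); rewrite -prodE mulrC.
have hs_perm := perm_to_rem hhs.
have sz : size hs = (size (rem h hs)).+1 by rewrite (perm_size hs_perm).
have remP g : g \in rem h hs -> g \isn't a GRing.unit.
  by move=> /mem_rem; apply: hsP.
have {}prodE : \prod_(q <- ps) q = u * (w * \prod_(g <- rem h hs) g).
  apply: (mulfI p0); rewrite prodE (perm_big _ hs_perm) big_cons /= {1}hE.
  by ring.
have [wU|wU] := boolP (w \is a GRing.unit).
  have uwU : u * w \is a GRing.unit by rewrite unitrM uU.
  rewrite mulrA in prodE.
  have [szle mat] := IH _ _ uwU psP remP prodE.
  rewrite sz /=; split=> // -[/mat[z [zps zhs zr]]].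
  exists ((p, h) :: z); split.
  - by rewrite /= perm_cons.
  - by rewrite (permPr hs_perm) /= perm_cons.
  - move=> x y; rewrite inE => /orP[/eqP[-> ->]|/zr//].
    by apply: associated_sym; exists w.
have [||szle _] := IH (w :: rem h hs) u uU psP.
- by move=> g; rewrite inE => /orP[/eqP->//|/remP].
- by rewrite big_cons.
rewrite sz; split=> /=; first exact: leqW.
by move=> szE; rewrite /= szE ltnn in szle.
Qed.

Lemma prime_divides_bigprod p (I : Type) (s : seq I) (P : pred I) (F : I -> A) :
  prime_elt p -> divides p (\prod_(i <- s | P i) F i) ->
  exists2 i, P i & divides p (F i).
Proof.
move=> pp; elim: s => [|i s IH].
  by rewrite big_nil => /prime_divides_unit; case=> //; rewrite unitr1.
rewrite big_cons; case: ifP => // Pi; case: (pp) => _ _ pP /pP[pi|/IH//].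
by exists i.
Qed.

(** In a domain primes are irreducible: the cofactor can only be a unit. *)
Lemma prime_divides_prime p q : prime_elt p -> prime_elt q -> divides p q ->
  associated p q.
Proof.
move=> [p0 pU _] [q0 qU qP] [w qE].
have /qP[[x wE]|[x pE]] : divides q (w * p) by exists 1; rewrite mul1r.
  case/negP: pU; apply/unitrP; exists x.
  suff xp : x * p = 1 by rewrite [p * x]mulrC xp.
  by apply: (mulfI q0); rewrite mulr1 {2}qE wE; ring.
apply: associated_sym; exists w => //; apply/unitrP; exists x.
suff xw : x * w = 1 by rewrite [w * x]mulrC xw.
by apply: (mulfI p0); rewrite mulr1 {2}pE qE; ring.
Qed.

(** The tangent equation of a product at a prime p of multiplicity k + 1, all
    other factors being gathered in Q: every term except that of the variation
    e of p is divisible by one more power of p. *)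
Lemma prime_divides_tangent p e Q E c gam k :
  prime_elt p -> ~ divides p Q -> c *+ k.+1 \is a GRing.unit ->
  gam * (p ^+ k.+1 * Q) + c * ((p ^+ k * e) *+ k.+1 * Q + p ^+ k.+1 * E) = 0 ->
  divides p e.
Proof.
move=> [p0 _ pP] pQ ckU.
rewrite exprS -[(_ * e) *+ _]mulr_natr => eq0.
have {}eq0 : gam * p * Q + (c * k.+1%:R * e) * Q + c * p * E = 0.
  apply: (mulfI (expf_neq0 k p0)); rewrite mulr0; apply: etrans eq0.
  by move: k.+1%:R (p ^+ k) => N pk; ring.
have /pP[[w wE]|//] : divides p ((c *+ k.+1 * e) * Q).
  exists (- (gam * Q + c * E)); apply/eqP; rewrite -subr_eq0 -[c *+ _]mulr_natr.
  by apply/eqP; apply: etrans eq0; move: k.+1%:R => N; ring.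
by exists ((c *+ k.+1)^-1 * w); rewrite -mulrA -wE mulKr.
Qed.

End Divisibility.

(** * Products of primes with multiplicities *)

Section Repeat.
Variable A : idomainType.
Implicit Types (s : seq (A * nat)).

Definition repeat_factors s : seq A := flatten [seq nseq fk.2 fk.1 | fk <- s].

Lemma prod_repeat_factors s :
  \prod_(x <- repeat_factors s) x = \prod_(fk <- s) fk.1 ^+ fk.2.
Proof.
elim: s => [|[x k] s IH]; first by rewrite !big_nil.
rewrite big_cons -IH /repeat_factors /= big_cat /=; congr (_ * _).
by elim: k => [|k IHk]; rewrite ?big_nil //= big_cons exprS IHk.
Qed.

Lemma mem_repeat_factors s x : x \in repeat_factors s -> exists2 fk, fk \in s & x = fk.1.
Proof.
by move=> /flatten_mapP[fk fks /nseqP[-> _]]; exists fk.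
Qed.

Lemma repeat_factors_mem s fk : fk \in s -> (0 < fk.2)%N -> fk.1 \in repeat_factors s.
Proof.
by move=> fks k0; apply/flatten_mapP; exists fk => //; apply/nseqP.
Qed.

(** Comparing both ways shows that the two lists have the same length. *)
Lemma unique_factorization (ps qs : seq A) u :
  u \is a GRing.unit -> (forall p, p \in ps -> prime_elt p) ->
  (forall q, q \in qs -> prime_elt q) ->
  \prod_(p <- ps) p = u * \prod_(q <- qs) q -> matched (@associated A) ps qs.
Proof.
move=> uU psP qsP prodE.
have nonunit (s : seq A) : (forall p, p \in s -> prime_elt p) ->
    forall p, p \in s -> p \isn't a GRing.unit.
  by move=> sP p /sP[].
have [szle mat] := primes_matched uU psP (nonunit _ qsP) prodE.
apply: mat; apply/eqP; rewrite eqn_leq szle /=.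
have uVU : u^-1 \is a GRing.unit by rewrite unitrV.
apply: (primes_matched uVU qsP (nonunit _ psP) _).1.
by rewrite prodE mulKr.
Qed.

Variables (r : nat) (k : 'I_r -> nat).

Definition repeat_family (F : 'I_r -> A) : seq A :=
  repeat_factors [seq (F j, k j) | j <- enum 'I_r].

Lemma prod_repeat_family F : \prod_(x <- repeat_family F) x = \prod_j F j ^+ k j.
Proof. by rewrite prod_repeat_factors big_map big_enum. Qed.

Lemma mem_repeat_family F x : x \in repeat_family F -> exists j, x = F j.
Proof. by move=> /mem_repeat_factors[fk /mapP[j _ ->] ->]; exists j. Qed.

Lemma repeat_family_mem F j : (0 < k j)%N -> F j \in repeat_family F.
Proof.
move=> k0; apply: (repeat_factors_mem (fk := (F j, k j))) => //.
by apply/mapP; exists j; rewrite ?mem_enum.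
Qed.

Lemma matched_repeat_family (rel : A -> A -> Prop) F H :
  (forall j, rel (F j) (H j)) -> matched rel (repeat_family F) (repeat_family H).
Proof.
move=> FH; exists (flatten [seq nseq (k j) (F j, H j) | j <- enum 'I_r]); split.
- rewrite /unzip1 map_flatten -map_comp /repeat_family /repeat_factors -map_comp.
  by under eq_map => j do rewrite /= map_nseq.
- rewrite /unzip2 map_flatten -map_comp /repeat_family /repeat_factors -map_comp.
  by under eq_map => j do rewrite /= map_nseq.
- by move=> x y /flatten_mapP[j _ /nseqP[[-> ->] _]].
Qed.

(** Both products have the same number of factors, so that each H j is one of
    the primes up to a unit.  Each of the r primes needs an H j of its own, so
    that two H j are never associated. *)
Lemma family_matched F H u :
  (forall j, 0 < k j)%N -> u \is a GRing.unit ->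
  (forall j, prime_elt (F j)) -> (forall i j, i != j -> ~ associated (F i) (F j)) ->
  (forall j, H j \isn't a GRing.unit) ->
  \prod_j F j ^+ k j = u * \prod_j H j ^+ k j ->
  [/\ matched (@associated A) (repeat_family F) (repeat_family H),
      forall j, prime_elt (H j)
    & forall i j, i != j -> ~ associated (H i) (H j)].
Proof.
move=> k0 uU FP Fd HU prodE.
have mat : matched (@associated A) (repeat_family F) (repeat_family H).
  rewrite -!prod_repeat_family in prodE.
  have [||_] := primes_matched uU _ _ prodE.
  - by move=> p /mem_repeat_family[j ->].
  - by move=> p /mem_repeat_family[j ->].
  by apply; apply/esym/(matched_size (matched_repeat_family (rel := fun _ _ => True) _)).
have [z [zF zH zr]] := mat.
have HF j : exists i, associated (F i) (H j).
  have : H j \in unzip2 z by rewrite (perm_mem zH) repeat_family_mem.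
  case/mapP=> -[x y] xyz /= ->; have : x \in unzip1 z by apply/mapP; exists (x, y).
  by rewrite (perm_mem zF) => /mem_repeat_family[i xE]; exists i; rewrite -xE; apply: zr.
have FH i : exists j, associated (F i) (H j).
  have : F i \in unzip1 z by rewrite (perm_mem zF) repeat_family_mem.
  case/mapP=> -[x y] xyz /= ->; have : y \in unzip2 z by apply/mapP; exists (x, y).
  by rewrite (perm_mem zH) => /mem_repeat_family[j yE]; exists j; rewrite -yE; apply: zr.
split=> //.
  by move=> j; have [i /associated_sym] := HF j; move=> /prime_associated; apply.
have [sg sgE] := choice FH.
have sg_inj : injective sg.
  move=> i i' sgii'; apply/eqP/negP => /negP ii'; apply: (Fd _ _ ii').
  apply: associated_trans (sgE i) _; rewrite sgii'; exact: associated_sym.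
have [sgV sgK sgVK] := injF_bij sg_inj.
move=> i j; rewrite -(sgVK i) -(sgVK j) (inj_eq sg_inj) => ij Hij.
apply: (Fd _ _ ij); apply: associated_trans (sgE _) _.
by apply: associated_trans Hij _; apply: associated_sym.
Qed.

End Repeat.

(** * Gauss's lemma *)

Section Gauss.
Variable A : idomainType.
Implicit Types (a b c d e f q : {poly A}).

Lemma coef_dividesC (p : A) b i : divides p%:P b -> divides p b`_i.
Proof. by case=> c ->; exists c`_i; rewrite coefMC. Qed.

(** Compare leading coefficients: if p divides b c, it divides one of the
    leading coefficients, hence one of the leading terms may be dropped. *)
Lemma prime_polyC (p : A) : prime_elt p -> prime_elt p%:P.
Proof.
move=> [p0 pU pP]; split; first by rewrite polyC_eq0.
  by rewrite poly_unitE coefC /= negb_and pU orbT.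
move=> b c; have [n] := ubnP (size b + size c); elim: n b c => // n IH b c.
rewrite ltnS => szn.
have [->|b0] := eqVneq b 0; first by left; exists 0; rewrite mul0r.
have [->|c0] := eqVneq c 0; first by right; exists 0; rewrite mul0r.
pose lt d : {poly A} := lead_coef d *: 'X^((size d).-1).
have size_lt d : d != 0 -> (size (d - lt d)%R < size d)%N.
  move=> d0; rewrite -[X in (_ < X)%N]prednK ?size_poly_gt0 // ltnS.
  apply/leq_sizeP => j; rewrite leq_eqVlt => /orP[/eqP<-|jd].
    by rewrite coefB coefZ coefXn eqxx mulr1 subrr.
  rewrite coefB coefZ coefXn (gtn_eqF jd) mulr0 subr0 nth_default //.
  by case: (size d) jd.
have dvd_lt d : divides p (lead_coef d) -> divides p%:P (lt d).
  by case=> k; rewrite /lt => ->; exists (k *: 'X^((size d).-1)); rewrite -!mul_polyC polyCM mulrAC.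
move=> pbc.
have : divides p (lead_coef b * lead_coef c).
  by rewrite -lead_coefM; apply: coef_dividesC.
case/pP => /dvd_lt dvd.
- have bE : b = (b - lt b) + lt b by rewrite subrK.
  have [||pb|] := IH (b - lt b) c; last by right.
  + by apply: leq_trans szn; rewrite ltn_add2r size_lt.
  + rewrite mulrBl; apply: dividesB => //.
    by rewrite mulrC; apply: divides_mull.
  + by left; rewrite bE; apply: dividesD.
- have cE : c = (c - lt c) + lt c by rewrite subrK.
  have [||pb|pc] := IH b (c - lt c); first last.
  + by right; rewrite cE; apply: dividesD.
  + by left.
  + by rewrite mulrBr; apply: dividesB => //; apply: divides_mull.
  + by apply: leq_trans szn; rewrite ltn_add2l size_lt.
Qed.

(** A prime constant p cannot divide q, whose degree is positive, so it divides
    the cofactor of q in p b and cancels. *)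
Lemma irreducible_cancelC (p : A) q b :
  prime_elt p -> irreducible_elt q -> (1 < size q)%N ->
  divides q (p%:P * b) -> divides q b.
Proof.
move=> pp [q0 qU qP] szq [t tE].
have [p0 pU pP] := prime_polyC pp.
have [[t' t'E]|[w wE]] : divides p%:P t \/ divides p%:P q.
- by apply: pP; exists b; rewrite -tE mulrC.
- by exists t'; apply: (mulfI p0); rewrite tE t'E mulrAC mulrC.
have [wU|] := qP _ _ wE; last by rewrite (negPf pU).
have [pn0 _ _] := pp.
move: szq wU; rewrite wE mulrC size_Cmul // poly_unitE.
by move=> szw /andP[/eqP szw1]; rewrite szw1 in szw.
Qed.

Hypothesis facA : factorial_domain A.

Lemma irreducible_cancel_const (c : A) q b :
  c != 0 -> irreducible_elt q -> (1 < size q)%N ->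
  divides q (c%:P * b) -> divides q b.
Proof.
move=> c0 qI szq; have [u [s [uU sP ->]]] := facA c0.
have uPU : u%:P \is a GRing.unit by exact: rmorph_unit.
rewrite polyCM -mulrA => -[t tE].
have {t tE} : divides q ((\prod_(p <- s) p)%:P * b).
  by exists (u%:P^-1 * t); rewrite -mulrA -tE mulKr.
elim: s sP b {c c0} => [_ b|p s IH sP b]; first by rewrite big_nil mul1r.
rewrite big_cons polyCM -mulrA => /irreducible_cancelC h.
apply: IH => [r rs|]; first by apply: sP; rewrite inE rs orbT.
by apply: h => //; apply: sP; rewrite mem_head.
Qed.

(** Each prime of the constant divides e or d and is cancelled there; c gathers
    those that were taken from d. *)
Lemma factor_primitive (s : seq A) q e d :
  (forall p, p \in s -> prime_elt p) ->
  (\prod_(p <- s) p)%:P * q = e * d ->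
  exists e1 d1 (c : A), q = e1 * d1 /\ d = c%:P * d1.
Proof.
elim: s e d => [|p s IH] e d sP.
  by rewrite big_nil mul1r => ->; exists e, d, 1; rewrite mul1r.
have {}IH e' d' := IH e' d' (fun r rs => sP r (mem_behead (rs : r \in behead (p :: s)))).
have [p0 _ pP] := prime_polyC (sP p (mem_head _ _)).
rewrite big_cons polyCM => pE.
have /pP[[e' e'E]|[d' d'E]] : divides p%:P (e * d).
  by rewrite -pE -mulrA; eexists; rewrite mulrC.
- apply: (IH e' d); apply: (mulfI p0); rewrite mulrA pE e'E.
  by rewrite mulrAC mulrC.
- have [|e1 [d1 [c [-> d'E2]]]] := IH e d'.
    by apply: (mulfI p0); rewrite mulrA pE d'E mulrA mulrC.
  exists e1, d1, (p * c); split=> //.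
  by rewrite d'E d'E2 polyCM mulrC mulrA.
Qed.

(** The pseudo-division of an element of the ideal (q, a) by an element of
    least degree leaves no remainder. *)
Lemma pseudo_bezout q a : q != 0 ->
  exists d x y, [/\ d != 0, d = x * q + y * a,
    exists2 c : A, c != 0 & divides d (c%:P * q)
    & exists2 c : A, c != 0 & divides d (c%:P * a)].
Proof.
move=> q0.
pose P n := `[< exists d x y, [/\ d != 0, d = x * q + y * a & size d = n] >].
have exP : exists n, P n.
  by exists (size q); apply/asboolP; exists q, 1, 0; rewrite mul1r mul0r addr0.
have [n /asboolP[d [x [y [d0 dE szd]]]] nmin] := ex_minnP exP.
have key t x' y' : t = x' * q + y' * a ->
    exists2 c : A, c != 0 & divides d (c%:P * t).
  move=> tE; exists (lead_coef d ^+ scalp t d).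
    by rewrite expf_neq0 // lead_coef_eq0.
  exists (t %/ d).
  rewrite mul_polyC Pdiv.Idomain.divp_eq.
  suff -> : t %% d = 0 by rewrite addr0.
  apply/eqP/negP => /negP r0.
  suff : (n <= size (t %% d)%R)%N.
    by rewrite -szd leqNgt Pdiv.Idomain.ltn_modp d0.
  apply: nmin; apply/asboolP.
  have rE := Pdiv.Idomain.divp_eq t d.
  set r := t %% d in rE *.
  set v := t %/ d in rE.
  set c := lead_coef d ^+ _ in rE.
  exists r, (c%:P * x' - v * x), (c%:P * y' - v * y); split=> //.
  have -> : r = c *: t - v * d by rewrite rE addrC addKr.
  rewrite -mul_polyC tE {1}dE !mulrBl !mulrDr !mulrA opprD addrACA.
  by [].
exists d, x, y; split=> //.
  by apply: (key q 1 0); rewrite mul1r mul0r addr0.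
by apply: (key a 0 1); rewrite mul1r mul0r add0r.
Qed.

(** Gauss's lemma.  A constant irreducible polynomial is one of the primes of
    the coefficient ring.  If q is not constant and divides a b, an element d of
    least degree of the ideal (q, a) divides q and a up to constants, which can
    be cancelled; as q is irreducible, up to constants and units d is q, and
    then q divides a, or d is 1, and then q divides b. *)
Lemma irreducible_prime_poly q : irreducible_elt q -> prime_elt q.
Proof.
move=> qI; have [q0 qU qP] := qI.
have [szq|szq] := leqP (size q) 1.
  have [c cE] : exists c : A, q = c%:P by exists q`_0; apply/size1_polyC.
  have c0 : c != 0 by rewrite -polyC_eq0 -cE.
  have [u [s [uU sP usE]]] := facA c0.
  case: s sP usE => [|p s] sP usE.
    by case/negP: qU; rewrite cE usE big_nil mulr1; apply: rmorph_unit.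
  have pp := prime_polyC (sP p (mem_head _ _)).
  have qE : q = (u * \prod_(r <- s) r)%:P * p%:P.
    by rewrite cE usE big_cons -polyCM; congr _%:P; rewrite -mulrA [p * _]mulrC.
  have [wU|] := qP _ _ qE; last by case: pp => _ /negPf->.
  by apply: prime_associated pp; rewrite qE; eexists; [exact: wU|].
split=> // a b qab.
have [d [x [y [d0 dE [c c0 [e cqE]] [c' c'0 [e' caE]]]]]] := pseudo_bezout a q0.
have [u [s [uU sP usE]]] := facA c0.
have uPU : u%:P \is a GRing.unit by exact: rmorph_unit.
have /(factor_primitive sP)[e1 [d1 [k [qE dE1]]]] :
    (\prod_(p <- s) p)%:P * q = (u%:P^-1 * e) * d.
  by rewrite -mulrA -cqE usE polyCM -mulrA mulKr.
have [e1U|d1U] := qP _ _ qE.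
- left; apply: (irreducible_cancel_const c'0 qI szq).
  rewrite caE; apply: divides_mull; rewrite dE1; apply: divides_mull.
  by exists e1^-1; rewrite qE mulKr.
- right.
  have k0 : k != 0 by apply: contraNneq d0 => kE; rewrite dE1 kE mul0r.
  apply: (irreducible_cancel_const k0 qI szq).
  have -> : k%:P * b = d1^-1 * (d * b).
    by rewrite dE1 [k%:P * d1]mulrC -mulrA mulKr.
  apply: divides_mull; rewrite dE mulrDl; apply: dividesD.
    by exists (x * b); rewrite mulrAC.
  by rewrite -mulrA; apply: divides_mull.
Qed.

End Gauss.

(** * Unique factorization of multivariate polynomials *)

Section IsoTransfer.
Variables (A B : idomainType) (phi : {rmorphism A -> B}) (psi : {rmorphism B -> A}).
Hypotheses (phiK : cancel phi psi) (psiK : cancel psi phi).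

Lemma iso_unit a : (phi a \is a GRing.unit) = (a \is a GRing.unit).
Proof.
by apply/idP/idP => [/(rmorph_unit psi)|/(rmorph_unit phi)//]; rewrite phiK.
Qed.

Lemma iso_irreducible a : irreducible_elt a -> irreducible_elt (phi a).
Proof.
move=> [a0 aU aP]; split.
- by apply: contraNneq a0 => pa0; rewrite -[a]phiK pa0 rmorph0.
- by rewrite iso_unit.
- move=> b c pabc; have /aP : a = psi b * psi c by rewrite -rmorphM -pabc phiK.
  by rewrite -!iso_unit !psiK.
Qed.

Lemma iso_prime a : prime_elt (phi a) -> prime_elt a.
Proof.
move=> [a0 aU aP]; split.
- by apply: contraNneq a0 => ->; rewrite rmorph0.
- by rewrite -iso_unit.
- move=> b c [d bcE].
  have dvd e : divides (phi a) (phi e) -> divides a e.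
    by case=> k kE; exists (psi k); rewrite -[e]phiK kE rmorphM phiK.
  have /aP[/dvd|/dvd] : divides (phi a) (phi b * phi c).
    by exists (phi d); rewrite -!rmorphM bcE.
  by left. by right.
Qed.

End IsoTransfer.

Section MPolyUFD.
Variable K : fieldType.

Lemma mpoly_unit_msize n (p : mpoly n K) :
  (p \is a GRing.unit) = (msize p == 1%N).
Proof.
apply/idP/idP => [|/eqP p1].
  rewrite /GRing.unit /= => /andP[/eqP pE]; rewrite unitfE => c0.
  by rewrite pE msizeC c0.
have pE := msize1_polyC (eq_leq p1); rewrite pE; apply: rmorph_unit.
by rewrite unitfE; apply: contra_eqN p1 => /eqP p0; rewrite pE p0 msizeC eqxx.
Qed.

(** Nonunits have positive total degree and degrees add up, so that a proper
    factor has smaller degree. *)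
Lemma irreducible_factorization_exists n (p : mpoly n K) : p != 0 ->
  exists u s, [/\ u \is a GRing.unit, forall q, q \in s -> irreducible_elt q
    & p = u * \prod_(q <- s) q].
Proof.
have [k] := ubnP (msize p); elim: k p => // k IH p; rewrite ltnS => szp p0.
have [pU|pU] := boolP (p \is a GRing.unit).
  by exists p, [::]; split=> //; rewrite big_nil mulr1.
have [pI|pI] := pselect (irreducible_elt p).
  exists 1, [:: p]; split; rewrite ?unitr1 ?big_seq1 ?mul1r //.
  by move=> q; rewrite inE => /eqP->.
have [a [b [pE aU bU]]] : exists a b, [/\ p = a * b, a \isn't a GRing.unit
    & b \isn't a GRing.unit].
  apply: contrapT => nab; apply: pI; split=> // a b pE.
  have [|aU] := boolP (a \is a GRing.unit); first by left.
  have [|bU] := boolP (b \is a GRing.unit); first by right.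
  by case: nab; exists a, b.
have a0 : a != 0 by apply: contraNneq p0 => a0; rewrite pE a0 mul0r.
have b0 : b != 0 by apply: contraNneq p0 => b0; rewrite pE b0 mulr0.
have big (q : mpoly n K) : q != 0 -> q \isn't a GRing.unit -> (1 < msize q)%N.
  move=> q0; rewrite mpoly_unit_msize; move: q0.
  by rewrite -msize_poly_eq0; case: (msize q) => [|[]].
have szE : msize p = (msize a + msize b).-1 by rewrite pE msizeM.
have := big _ a0 aU; have := big _ b0 bU => sza szb.
have [||u [s [uU sP aE]]] := IH a; [|by []|].
  apply: leq_trans szp; rewrite szE; case: (msize b) sza => [|[]] // m _.
  by rewrite !addnS ltnS leq_addr.
have [||v [t [vU tP bE]]] := IH b; [|by []|].
  apply: leq_trans szp; rewrite szE; case: (msize a) szb => [|[]] // m _.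
  by rewrite !addSn ltnS leq_addl.
exists (u * v), (s ++ t); split.
- by rewrite unitrM uU.
- by move=> q; rewrite mem_cat => /orP[/sP|/tP].
- by rewrite big_cat pE aE bE /=; ring.
Qed.

(** Evaluation at the last variable, which inverts muni. *)
Definition munify n (q : {poly mpoly n K}) : mpoly n.+1 K :=
  horner_eval (mpolyX K (mnm1 ord_max)) (map_poly (@mwiden n K) q).

HB.instance Definition _ n := GRing.RMorphism.copy (@munify n)
  (horner_eval (mpolyX K (mnm1 ord_max)) \o map_poly (@mwiden n K)).

Lemma muniX n (m : multinom n.+1) :
  muni (mpolyX K m) =
    mpolyX K (Multinom [tuple m (widen_ord (leqnSn n) i) | i < n]) *: 'X^(m ord_max).
Proof. by rewrite muniE msuppX big_seq1 mcoeffX eqxx scale1r. Qed.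

Lemma munifyZXn n (c : mpoly n K) k :
  munify (c *: 'X^k) = mwiden c * mpolyX K (mnm1 ord_max) ^+ k.
Proof. by rewrite /munify map_polyZ map_polyXn /horner_eval hornerZ hornerXn. Qed.

Lemma muniK n : cancel (@muni n K) (@munify n).
Proof.
move=> p; rewrite muniE raddf_sum [RHS]mpolyE; apply: eq_bigr => m _ /=.
rewrite munifyZXn mwidenZ mwidenX mpolyXn -scalerAl -mpolyXD; congr (_ *: mpolyX _ _).
apply/mnmP => i; rewrite mnmDE mulmnE mnm1E.
case: (unliftP ord_max i) => [j ->|->].
  have -> : lift ord_max j = widen_ord (leqnSn n) j by apply: ord_inj; rewrite lift_max.
  rewrite mnmwiden_widen mnmE.
  have /negPf-> : ord_max != widen_ord (leqnSn n) j.
    by rewrite -val_eqE /= gtn_eqF.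
  by rewrite mul0n addn0.
by rewrite mnmwiden_ordmax eqxx mul1n add0n.
Qed.

Lemma muni_mwiden n (c : mpoly n K) : muni (mwiden c) = c%:P.
Proof.
rewrite (mwidenE (leqnn _)) [in RHS](mpolywE (leqnn (msize c))) !rmorph_sum.
apply: eq_bigr => m _ /=; rewrite muniZ muniX mnmwiden_ordmax expr0.
have -> : Multinom [tuple mnmwiden m (widen_ord (leqnSn n) i) | i < n] = m :> multinom n.
  by apply/mnmP => i; rewrite mnmE mnmwiden_widen.
by rewrite alg_polyC -mul_polyC -polyCM mul_mpolyC.
Qed.

Lemma munifyK n : cancel (@munify n) (@muni n K).
Proof.
elim/poly_ind => [|q c IH]; first by rewrite !raddf0.
have cE : munify c%:P = mwiden c by rewrite -[c%:P]alg_polyC -[1](expr0 'X) munifyZXn expr0 mulr1.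
have XE : @munify n 'X = mpolyX K (mnm1 ord_max).
  by rewrite -['X]scale1r -['X]expr1 munifyZXn rmorph1 mul1r expr1.
rewrite rmorphD rmorphM /= rmorphD rmorphM /= IH cE XE muni_mwiden; congr (_ * _ + _).
rewrite muniX mnm1E eqxx expr1.
have -> : Multinom [tuple mnm1 ord_max (widen_ord (leqnSn n) i) | i < n] = mnm0 :> multinom n.
  apply/mnmP => i; rewrite mnmE mnm1E mnm0E.
  by rewrite -val_eqE /= gtn_eqF.
by rewrite mpolyX0 scale1r.
Qed.

(** Induction on the number of variables: polynomials in n + 1 variables are
    univariate over a ring that is factorial by induction, and Gauss's lemma
    applies. *)
Lemma mpoly_irreducible_prime n (p : mpoly n K) :
  irreducible_elt p -> prime_elt p.
Proof.
elim: n p => [p [p0 pU _]|n IH p pI].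
  case/negP: pU; rewrite mpoly_unit_msize.
  have pc0 : mcoeff mnm0 p != 0.
    by apply: contraNneq p0 => pc0; rewrite (nvar0_mpolyC p) pc0 mpolyC0.
  by rewrite (nvar0_mpolyC p) msizeC pc0.
apply: (iso_prime (@muniK n)).
apply: irreducible_prime_poly; last exact: (iso_irreducible (@muniK n) (@munifyK n)).
move=> a /irreducible_factorization_exists[u [s [uU sP aE]]].
by exists u, s; split=> // q /sP/IH.
Qed.

End MPolyUFD.

(** * Degrees in each variable *)

Section VariableDegree.
Variables (K : idomainType) (l : nat).
Implicit Types (p q : mpoly l K) (m : multinom l) (i : 'I_l).

Definition vdeg i p : nat := \max_(m <- msupp p) (m : multinom l) i.

Lemma coef_le_vdeg i p m : mcoeff m p != 0 -> (m i <= vdeg i p)%N.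
Proof.
rewrite -mcoeff_msupp => mp.
exact: (@leq_bigmax_seq _ _ _ (fun m : multinom l => m i : nat) m).
Qed.

Lemma vdeg_le i p b :
  (forall m, mcoeff m p != 0 -> (m i <= b)%N) -> (vdeg i p <= b)%N.
Proof.
move=> h; apply/bigmax_leqP_seq => m mp _.
by apply: h; rewrite -mcoeff_msupp.
Qed.

Lemma vdeg_attained i p : p != 0 ->
  exists2 m, mcoeff m p != 0 & m i = vdeg i p.
Proof.
move=> p0; apply: contrapT => none.
have lt m : mcoeff m p != 0 -> (m i < vdeg i p)%N.
  move=> pm; rewrite ltn_neqAle coef_le_vdeg // andbT.
  by apply/eqP => mE; apply: none; exists m.
have m0p := lt _ (etrans (esym (mcoeff_msupp _ _)) (mlead_supp p0)).
have d0 := leq_ltn_trans (leq0n _) m0p.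
have : (vdeg i p <= (vdeg i p).-1)%N.
  by apply: vdeg_le => m /lt; case: (vdeg i p) d0.
by case: (vdeg i p) d0 => // d _; rewrite ltnn.
Qed.

(** The variable of index i is tagged by a new variable, whose degree is then
    the degree in the variable of index i. *)
Definition tag_var (i : 'I_l) : mpoly l K -> {poly mpoly l K} :=
  mmap (polyC \o @mpolyC l _)
       (fun j => (mpolyX _ (mnm1 j))%:P * 'X^(i == j)).

HB.instance Definition _ i := GRing.RMorphism.on (tag_var i).

Lemma tag_varE i p :
  tag_var i p = \sum_(m <- msupp p) (mcoeff m p *: mpolyX _ m) *: 'X^(m i).
Proof.
apply: eq_bigr => m _; rewrite /= /mmap1.
under eq_bigr => j _ do rewrite exprMn -rmorphXn -exprM.
rewrite big_split -rmorph_prod /= -mpolyXE_id -mul_polyC -mul_mpolyC polyCM mulrA.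
congr (_ * _); rewrite (bigD1 i) //= eqxx mul1n big1 ?mulr1 // => j.
by rewrite eq_sym => /negPf->.
Qed.

Lemma mcoeff_tag_var i p j m :
  mcoeff m (tag_var i p)`_j = mcoeff m p * (m i == j)%:R.
Proof.
rewrite tag_varE coef_sum raddf_sum [in RHS](mpolyE p) raddf_sum mulr_suml.
apply: eq_bigr => m' _ /=; rewrite coefZ coefXn mulr_natr raddfMn /=.
rewrite !mcoeffZ mcoeffX [j == _]eq_sym.
by have [->|_] := eqVneq m' m; rewrite !mulr_natr // mulr0n !mul0rn.
Qed.

Lemma size_tag_var i p : p != 0 -> size (tag_var i p) = (vdeg i p).+1.
Proof.
move=> p0; apply/eqP; rewrite eqn_leq; apply/andP; split.
  apply/leq_sizeP => j ltj; apply/mpolyP => m; rewrite mcoeff_tag_var mcoeff0.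
  have [->|pm] := eqVneq (mcoeff m p) 0; first by rewrite mul0r.
  by rewrite ltn_eqF ?mulr0 // (leq_ltn_trans (coef_le_vdeg i pm)).
have [m pm mE] := vdeg_attained i p0.
rewrite ltnNge; apply/negP => /leq_sizeP /(_ _ (leqnn _)) tag0.
move: (mcoeff_tag_var i p (vdeg i p) m).
by rewrite tag0 mcoeff0 mE eqxx mulr1 => /esym/eqP; rewrite (negPf pm).
Qed.

(** Degrees of univariate polynomials over a domain add up. *)
Lemma vdegM i p q : p != 0 -> q != 0 -> vdeg i (p * q) = (vdeg i p + vdeg i q)%N.
Proof.
move=> p0 q0; have tag0 r : r != 0 -> tag_var i r != 0.
  by move=> r0; rewrite -size_poly_gt0 size_tag_var.
have := size_tag_var i (mulf_neq0 p0 q0).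
have -> : tag_var i (p * q) = tag_var i p * tag_var i q := rmorphM _ _ _.
move: (tag0 p p0) (tag0 q q0) (size_tag_var i p0) (size_tag_var i q0).
move: (tag_var i p) (tag_var i q) => P Q P0 Q0 szP szQ.
by rewrite size_mul // szP szQ addSn addnS => -[->].
Qed.

End VariableDegree.

Section Multidegree.
Variables (R : realType) (l : nat).
Implicit Types (p q : cpoly R l) (m : multidegree l).

Lemma multidegE p i : multideg p i = vdeg i p.
Proof. by rewrite /multideg multinomE tnth_mktuple. Qed.

Lemma coef_le_multideg p m i : mcoeff m p != 0 -> (m i <= multideg p i)%N.
Proof. by rewrite multidegE; apply: coef_le_vdeg. Qed.

Lemma multideg_le p i b :
  (forall m, mcoeff m p != 0 -> (m i <= b)%N) -> (multideg p i <= b)%N.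
Proof. by rewrite multidegE; apply: vdeg_le. Qed.

Lemma multidegM p q : p != 0 -> q != 0 ->
  multideg (p * q) = mnm_add (multideg p) (multideg q).
Proof.
by move=> p0 q0; apply/mnmP => i; rewrite mnmDE !multidegE; apply: vdegM.
Qed.

Lemma multidegC (c : R[i]) : multideg (mpolyC l c) = mnm0.
Proof.
apply/mnmP => i; apply/eqP; rewrite mnm0E -leqn0; apply: multideg_le => m.
rewrite mcoeffC; have [->|_] := eqVneq m mnm0; first by rewrite mnm0E.
by rewrite mulr0 eqxx.
Qed.

Lemma multideg1 : multideg (1 : cpoly R l) = mnm0.
Proof. by rewrite -mpolyC1 multidegC. Qed.

Lemma multidegX p k : p != 0 -> multideg (p ^+ k) = mnm_muln (multideg p) k.
Proof.
move=> p0; elim: k => [|k IH]; first by rewrite expr0 mulm0n multideg1.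
by rewrite exprS multidegM ?expf_neq0 // IH mulmS.
Qed.

Lemma multidegZ (c : R[i]) p : c != 0 -> multideg (c *: p) = multideg p.
Proof.
move=> c0; have [->|p0] := eqVneq p 0; first by rewrite scaler0.
rewrite -mul_mpolyC multidegM ?mpolyC_eq0 // multidegC.
by apply/mnmP => i; rewrite mnmDE mnm0E add0n.
Qed.

Lemma multideg_prod (I : Type) (s : seq I) (P : I -> cpoly R l) i :
  (forall j, P j != 0) ->
  multideg (\prod_(j <- s) P j) i = (\sum_(j <- s) multideg (P j) i)%N.
Proof.
move=> P0; elim: s => [|j s IH]; first by rewrite !big_nil multideg1 mnm0E.
have s0 : \prod_(j <- s) P j != 0.
  elim: s {IH} => [|k s IH]; first by rewrite big_nil oner_neq0.
  by rewrite big_cons mulf_neq0.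
by rewrite !big_cons (multidegM (P0 j) s0) mnmDE IH.
Qed.

(** All monomials of a polynomial of multidegree 0 are constant. *)
Lemma unit_multideg p : p != 0 -> (p \is a GRing.unit) = (multideg p == mnm0).
Proof.
move=> p0; apply/idP/eqP => [|d0].
  rewrite mpoly_unit_msize => /eqP p1.
  by rewrite (msize1_polyC (eq_leq p1)) multidegC.
have pE : p = mpolyC l (mcoeff mnm0 p).
  apply/mpolyP => m; rewrite mcoeffC.
  have [->|m0] := eqVneq m mnm0; first by rewrite mulr1.
  rewrite mulr0; apply/eqP; apply: contraTT m0 => pm; rewrite negbK.
  apply/eqP/mnmP => i; apply/eqP; rewrite mnm0E -leqn0.
  by have := coef_le_multideg i pm; rewrite d0 mnm0E.
rewrite pE; apply: rmorph_unit; rewrite unitfE.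
by apply: contraNneq p0 => c0; rewrite pE c0 mpolyC0.
Qed.

Lemma msize_le_multideg (p : cpoly R l) (d : multinom l) :
  (forall i, (multideg p i <= d i)%N) -> (msize p <= (mdeg d).+1)%N.
Proof.
move=> pd; rewrite msizeE; apply/bigmax_leqP_seq => m mp _; rewrite ltnS !mdegE.
apply: leq_sum => i _; apply: leq_trans (pd i); apply: coef_le_multideg.
by rewrite -mcoeff_msupp.
Qed.

Lemma multidegB_le (p q : cpoly R l) (d : multinom l) i :
  (multideg p i <= d i)%N -> (multideg q i <= d i)%N -> (multideg (p - q) i <= d i)%N.
Proof.
move=> pd qd; apply: multideg_le => m; rewrite mcoeffB => pqm.
have [pm|pm] := eqVneq (mcoeff m p) 0.
  apply: leq_trans qd; apply: coef_le_multideg.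
  by apply: contraNneq pqm => qm; rewrite pm qm subr0.
exact: leq_trans (coef_le_multideg i pm) pd.
Qed.

End Multidegree.

(** * The coefficient norm and the sine *)

Section CoefNorm.
Variables (R : realType) (l : nat).
Implicit Types (p q r : cpoly R l) (c d : R[i]).

Notation normc := ComplexField.Normc.normc.

Lemma ler_of_sqr (x y : R) : 0 <= y -> x ^+ 2 <= y ^+ 2 -> x <= y.
Proof. by move=> y0 xy; rewrite leNgt; apply/negP => yx; nra. Qed.

Lemma sqr_normcE c : (normc c ^+ 2)%:C%C = c^* * c.
Proof.
by rewrite mulrC -normCK rmorphXn.
Qed.

Lemma conj_real (x : R) : (x%:C%C : R[i])^* = x%:C%C.
Proof. exact: conjc_real. Qed.

Lemma normc_ge0 c : 0 <= normc c.
Proof. by case: c => a b; rewrite /normc sqrtr_ge0. Qed.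

(** The sums that define the norm and the dot product may be taken over any
    sequence that contains the support. *)
Lemma big_msupp (V : nmodType) (F : multinom l -> V) p (s : seq (multinom l)) :
  uniq s -> {subset msupp p <= s} -> (forall m, mcoeff m p = 0 -> F m = 0) ->
  \sum_(m <- msupp p) F m = \sum_(m <- s) F m.
Proof.
move=> us sub F0; rewrite [RHS](bigID (fun m => m \in msupp p)) /=.
rewrite [X in _ = _ + X]big1 ?addr0; last first.
  by move=> m; rewrite mcoeff_msupp negbK => /eqP/F0.
rewrite -[RHS]big_filter; apply/perm_big/uniq_perm; rewrite ?filter_uniq ?msupp_uniq //.
by move=> m; rewrite mem_filter; have [/sub|] := boolP (m \in msupp p).
Qed.

Lemma coef_dotE p q s : uniq s -> {subset msupp p <= s} ->
  coef_dot p q = \sum_(m <- s) (mcoeff m p)^* * mcoeff m q.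
Proof.
by move=> us sub; apply: big_msupp => // m ->; rewrite rmorph0 mul0r.
Qed.

Lemma coef_dotC p q : coef_dot p q = (coef_dot q p)^*.
Proof.
pose s := undup (msupp p ++ msupp q).
rewrite (@coef_dotE p q s) ?(@coef_dotE q p s) ?undup_uniq //.
- rewrite rmorph_sum; apply: eq_bigr => m _.
  by rewrite rmorphM /= conjCK mulrC.
- by move=> m mq; rewrite mem_undup mem_cat mq orbT.
- by move=> m mq; rewrite mem_undup mem_cat mq.
Qed.

Lemma coef_dotBr p q r : coef_dot p (q - r) = coef_dot p q - coef_dot p r.
Proof. by rewrite -sumrB; apply: eq_bigr => m _; rewrite mcoeffB mulrBr. Qed.

Lemma coef_dotZr c p q : coef_dot p (c *: q) = c * coef_dot p q.
Proof. by rewrite mulr_sumr; apply: eq_bigr => m _; rewrite mcoeffZ mulrCA. Qed.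

Lemma coef_dotBl p q r : coef_dot (p - q) r = coef_dot p r - coef_dot q r.
Proof. by rewrite coef_dotC coef_dotBr rmorphB /= -!coef_dotC. Qed.

Lemma coef_dotZl c p q : coef_dot (c *: p) q = c^* * coef_dot p q.
Proof. by rewrite coef_dotC coef_dotZr rmorphM /= -!coef_dotC. Qed.

Lemma pnorm_ge0 p : 0 <= pnorm p.
Proof. exact: sqrtr_ge0. Qed.

Lemma sqr_pnorm p : pnorm p ^+ 2 = \sum_(m <- msupp p) normc (mcoeff m p) ^+ 2.
Proof. by rewrite sqr_sqrtr // sumr_ge0 // => m _; rewrite sqr_ge0. Qed.

Lemma pnorm_dot p : (pnorm p ^+ 2)%:C%C = coef_dot p p.
Proof.
rewrite sqr_pnorm rmorph_sum; apply: eq_bigr => m _; exact: sqr_normcE.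
Qed.

Lemma normc_le_pnorm p m : normc (mcoeff m p) <= pnorm p.
Proof.
apply: ler_of_sqr (pnorm_ge0 p) _; rewrite sqr_pnorm.
have [mp|] := boolP (m \in msupp p).
  rewrite (bigD1_seq m) //= lerDl sumr_ge0 // => k _; exact: sqr_ge0.
rewrite mcoeff_msupp negbK => /eqP->; rewrite ComplexField.Normc.normc0 expr0n /=.
by rewrite sumr_ge0 // => k _; rewrite sqr_ge0.
Qed.

Lemma pnorm_le_sum p s : uniq s -> {subset msupp p <= s} ->
  pnorm p <= \sum_(m <- s) normc (mcoeff m p).
Proof.
move=> us sub.
have ge0 (t : seq (multinom l)) : 0 <= \sum_(m <- t) normc (mcoeff m p).
  by rewrite sumr_ge0 // => m _; rewrite normc_ge0.
apply: ler_of_sqr (ge0 s) _; rewrite sqr_pnorm.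
rewrite (big_msupp us sub) => [|m ->]; last first.
  by rewrite ComplexField.Normc.normc0 expr0n.
elim: s {us sub} => [|m s IH]; first by rewrite !big_nil expr0n.
rewrite !big_cons; have := ge0 s; have := normc_ge0 (mcoeff m p).
set a := normc _ in IH *; set b := \sum_(_ <- _) _ in IH *; set e := \sum_(_ <- _) _ in IH *.
by move=> a0 b0; nra.
Qed.

Lemma pnormZ c p : pnorm (c *: p) = normc c * pnorm p.
Proof.
apply/eqP; rewrite -(eqrXn2 (ltn0Sn 1)) ?mulr_ge0 ?pnorm_ge0 ?normc_ge0 //.
apply/eqP/complexI; rewrite pnorm_dot exprMn rmorphM /= pnorm_dot sqr_normcE.
by rewrite coef_dotZl coef_dotZr; ring.
Qed.

Lemma pnormBC (p q : cpoly R l) : pnorm (p - q) = pnorm (q - p).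
Proof.
rewrite -opprB -scaleN1r pnormZ /= oppr0 expr0n /= addr0 sqrrN expr1n sqrtr1.
by rewrite mul1r.
Qed.

Lemma pnorm_gt0 p : p != 0 -> 0 < pnorm p.
Proof.
move=> p0; have := mlead_supp p0; rewrite mcoeff_msupp => pm.
apply: lt_le_trans (normc_le_pnorm p (mlead p)).
rewrite lt_neqAle normc_ge0 andbT eq_sym; apply: contraNneq pm => h.
by apply/eqP/ComplexField.Normc.eq0_normc.
Qed.

(** By Pythagoras the orthogonal projection, which defines the sine, is the
    point of the line spanned by q that is nearest to p/|p|. *)
Lemma psin_le p q c : p != 0 -> q != 0 ->
  psin p q <= pnorm (((pnorm p)%:C%C)^-1 *: p - c *: q).
Proof.
move=> p0 q0; rewrite /psin.
set a := _ *: p; set b := _ *: q.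
have nz r : r != 0 -> (pnorm r)%:C%C != 0 :> R[i].
  by move=> /pnorm_gt0 r0; rewrite fmorph_eq0 gt_eqF.
have [np0 nq0] := (nz p p0, nz q q0).
have conjV r : (((pnorm r)%:C%C)^-1 : R[i])^* = ((pnorm r)%:C%C)^-1.
  by rewrite fmorphV /= conj_real.
have bb : coef_dot b b = 1.
  rewrite coef_dotZl coef_dotZr conjV -pnorm_dot rmorphXn /=.
  by field.
have ba : coef_dot q p / (pnorm q * pnorm p)%:C%C = coef_dot b a.
  rewrite coef_dotZl coef_dotZr conjV rmorphM /=.
  by field; rewrite np0 nq0.
have -> : c *: q = (c * (pnorm q)%:C%C) *: b by rewrite scalerA mulfK.
rewrite ba; move: {c}(c * _) => d; set e := coef_dot b a.
clear ba; clearbody a b.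
apply: ler_of_sqr (pnorm_ge0 _) _; rewrite -subr_ge0.
suff : (pnorm (a - d *: b) ^+ 2 - pnorm (a - e *: b) ^+ 2)%:C%C = (normc (d - e) ^+ 2)%:C%C.
  by move/complexI => ->; rewrite sqr_ge0.
rewrite rmorphB /= !pnorm_dot sqr_normcE rmorphB.
rewrite !coef_dotBl !coef_dotBr !coef_dotZl !coef_dotZr bb.
rewrite [coef_dot a b]coef_dotC -/e; ring.
Qed.

(** Scaling p and q does not matter: the bound for the sine is tested on the
    multiple of q that corresponds to g. *)
Lemma psin_le_proportional p q h g u v : h != 0 -> g != 0 -> u != 0 -> v != 0 ->
  p = u *: h -> q = v *: g -> psin p q <= pnorm (h - g) / pnorm h.
Proof.
move=> h0 g0 u0 v0 pE qE.
have p0 : p != 0 by rewrite pE scaler_eq0 negb_or u0.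
have q0 : q != 0 by rewrite qE scaler_eq0 negb_or v0.
set n := ((pnorm p)%:C%C)^-1.
apply: le_trans (psin_le (n * u / v) p0 q0) _.
rewrite -/n {1}pE {1}qE !scalerA divfK // -scalerBr pnormZ ComplexField.Normc.normcM.
have nu : normc u != 0.
  by apply: contraNneq u0 => /ComplexField.Normc.eq0_normc ->.
have nh : pnorm h != 0 by rewrite gt_eqF // pnorm_gt0.
have -> : normc n = (pnorm p)^-1.
  rewrite /n ComplexField.Normc.normcV; congr _^-1; apply/eqP.
  by rewrite /= expr0n /= addr0 sqrtr_sqr ger0_norm // pnorm_ge0.
rewrite [X in X <= _](_ : _ = pnorm (h - g) / pnorm h) // pE pnormZ.
by field; rewrite nu nh.
Qed.

End CoefNorm.

(** * The distance between factorizations *)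

Section Distance.
Variables (R : realType) (l : nat).
Implicit Types (ps qs : seq (cpoly R l)) (e : R).

Lemma dist_le (a b : R[i]) ps qs e : 0 <= e ->
  matched (fun p q => psin p q <= e) ps qs -> dist (a, ps) (b, qs) <= e.
Proof.
move=> e0 [z [zps zqs zr]].
have [z' z'z z'ps] := perm_map_inv zps.
have zqs' : perm_eq qs (unzip2 z').
  by rewrite -(permPl zqs) perm_sym; apply: perm_map.
have {}zr x y : (x, y) \in z' -> psin x y <= e by rewrite (perm_mem z'z) => /zr.
have sz : size qs = size ps.
  by rewrite -z'ps (perm_size zqs') !size_map.
have /tuple_permP[sg sgE] : perm_eq (unzip2 z') (Tuple (introT eqP sz)).
  by rewrite perm_sym.
rewrite /dist /= sz eqxx; apply: (le_trans (bigmin_le _ sg _)).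
apply: bigmax_le => // j _; apply: zr.
have jz : (j < size z')%N by rewrite -(size_map fst z') [map _ _]z'ps.
have -> : nth 0 ps j = (nth (0, 0) z' j).1 by rewrite -(nth_map _ 0) // [map _ _]z'ps.
have -> : nth 0 qs (sg j) = (nth (0, 0) z' j).2.
  rewrite -(nth_map _ 0) // [map _ _]sgE.
  by rewrite (nth_map j) ?size_enum_ord // nth_ord_enum (tnth_nth 0).
by rewrite -surjective_pairing mem_nth.
Qed.

End Distance.

Import numFieldNormedType.Exports.
Local Open Scope classical_set_scope.

(** * Limits of polynomials along an ultrafilter *)

Section Limits.
Variables (R : realType) (T : Type) (U : set_system T).
Context {UU : UltraFilter U}.
Implicit Types (y z : T -> R[i]) (c d : R[i]).

Notation normc := ComplexField.Normc.normc.

(** Convergence of both parts, to which the limit theorems of R apply. *)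
Definition ccvg z c : Prop :=
  (fun t => complex.Re (z t)) @ U --> complex.Re c /\
  (fun t => complex.Im (z t)) @ U --> complex.Im c.

Lemma ccvg_cst c : ccvg (fun _ => c) c.
Proof. by split; apply: cvg_cst. Qed.

Lemma ccvg_near y z c : (\forall t \near U, y t = z t) -> ccvg y c -> ccvg z c.
Proof.
move=> yz [re im]; split; [apply: cvg_trans re|apply: cvg_trans im];
  apply: near_eq_cvg; near=> t; congr (_ _); near: t; apply: filterS yz => t //.
Unshelve. all: by end_near.
Qed.

Lemma ccvgD y z c d : ccvg y c -> ccvg z d -> ccvg (fun t => y t + z t) (c + d).
Proof.
move=> [yr yi] [zr zi]; split.
  have -> : complex.Re (c + d) = complex.Re c + complex.Re d by case: c d {yr yi zr zi} => [? ?] [].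
  rewrite [X in X @ _](_ : _ = (fun t => complex.Re (y t)) \+ (fun t => complex.Re (z t))).
    exact: cvgD.
  by apply/funext => t /=; case: (y t) (z t) => [? ?] [].
have -> : complex.Im (c + d) = complex.Im c + complex.Im d by case: c d {yr yi zr zi} => [? ?] [].
rewrite [X in X @ _](_ : _ = (fun t => complex.Im (y t)) \+ (fun t => complex.Im (z t))).
  exact: cvgD.
by apply/funext => t /=; case: (y t) (z t) => [? ?] [].
Qed.

Lemma ccvgM y z c d : ccvg y c -> ccvg z d -> ccvg (fun t => y t * z t) (c * d).
Proof.
move=> [yr yi] [zr zi].
have ReM (a b : R[i]) : complex.Re (a * b) =
  complex.Re a * complex.Re b - complex.Im a * complex.Im b by case: a b => [? ?] [].
have ImM (a b : R[i]) : complex.Im (a * b) =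
  complex.Re a * complex.Im b + complex.Im a * complex.Re b by case: a b => [? ?] [].
split.
  rewrite ReM.
  under [X in X @ _]funext do rewrite ReM.
  by apply: cvgB; apply: cvgM.
rewrite ImM.
under [X in X @ _]funext do rewrite ImM.
by apply: cvgD; apply: cvgM.
Qed.

Lemma ccvgN z c : ccvg z c -> ccvg (fun t => - z t) (- c).
Proof.
move=> zc; rewrite -mulN1r; under eq_fun do rewrite -mulN1r.
exact: ccvgM (ccvg_cst _) zc.
Qed.

Lemma ccvgB y z c d : ccvg y c -> ccvg z d -> ccvg (fun t => y t - z t) (c - d).
Proof. by move=> yc zd; apply: ccvgD yc (ccvgN zd). Qed.

Lemma ccvg_sum (I : Type) (s : seq I) (P : pred I) (z : I -> T -> R[i]) (c : I -> R[i]) :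
  (forall i, ccvg (z i) (c i)) ->
  ccvg (fun t => \sum_(i <- s | P i) z i t) (\sum_(i <- s | P i) c i).
Proof.
move=> zc; elim: s => [|i s IH].
  by rewrite big_nil; under eq_fun do rewrite big_nil; apply: ccvg_cst.
rewrite big_cons; under eq_fun do rewrite big_cons.
by case: (P i) => //; apply: ccvgD.
Qed.

Lemma ccvg_unique z c d : ccvg z c -> ccvg z d -> c = d.
Proof.
move=> [zr zi] [zr' zi'].
case: c d zr zi zr' zi' => [a b] [a' b'] /= zr zi zr' zi'.
by congr (_ +i* _)%C; [apply: cvg_unique zr zr' | apply: cvg_unique zi zi'].
Qed.

Lemma normcE c : normc c = Num.sqrt (complex.Re c ^+ 2 + complex.Im c ^+ 2).
Proof. by case: c. Qed.

Lemma ccvg_normc z c : ccvg z c -> (fun t => normc (z t)) @ U --> normc c.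
Proof.
move=> [zr zi].
rewrite normcE; under [X in X @ _]funext do rewrite normcE.
apply: (@continuous_cvg _ _ _ _ _
  (fun t => complex.Re (z t) ^+ 2 + complex.Im (z t) ^+ 2) Num.sqrt).
  exact: sqrt_continuous.
by apply: cvgD; apply: cvgM.
Qed.

Lemma ccvg_neq0 z c : c != 0 -> ccvg z c -> \forall t \near U, z t != 0.
Proof.
move=> c0 /ccvg_normc zc.
have nc : normc c != 0 by apply: contraNneq c0 => /ComplexField.Normc.eq0_normc ->.
apply: filterS (cvgr_neq0 _ zc nc) => t; apply: contraNneq => ->.
by rewrite ComplexField.Normc.normc0.
Qed.

Lemma ccvgV z c : c != 0 -> ccvg z c -> ccvg (fun t => (z t)^-1) c^-1.
Proof.
move=> c0 [zr zi].
have sq0 : complex.Re c ^+ 2 + complex.Im c ^+ 2 != 0.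
  apply: contraNneq c0; case: c {zr zi} => a b /= /eqP.
  by rewrite paddr_eq0 ?sqr_ge0 // !sqrf_eq0 => /andP[/eqP-> /eqP->].
have sqc : (fun t => complex.Re (z t) ^+ 2 + complex.Im (z t) ^+ 2) @ U -->
    complex.Re c ^+ 2 + complex.Im c ^+ 2 by apply: cvgD; apply: cvgM.
have ReV (a : R[i]) : complex.Re a^-1 =
  complex.Re a * (complex.Re a ^+ 2 + complex.Im a ^+ 2)^-1 by case: a.
have ImV (a : R[i]) : complex.Im a^-1 =
  - (complex.Im a * (complex.Re a ^+ 2 + complex.Im a ^+ 2)^-1) by case: a.
split.
  rewrite ReV; under [X in X @ _]funext do rewrite ReV.
  by apply: cvgM => //; apply: cvgV.
rewrite ImV; under [X in X @ _]funext do rewrite ImV.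
by apply: cvgN; apply: cvgM => //; apply: cvgV.
Qed.

(** Along an ultrafilter a cluster point is a limit. *)
Lemma real_bounded_cvg (x : T -> R) (B : R) :
  (forall t, `|x t| <= B) -> exists a : R, x @ U --> a.
Proof.
move=> xB.
have inB : U (x @^-1` `[- B, B]%classic).
  by apply: filterS filterT => t _; rewrite /preimage /= in_itv /= -ler_norml.
have [a [_ acl]] := @segment_compact R (- B) B (x @ U) _ inB.
exists a => V aV.
have [//|VC] := in_ultra_setVsetC (x @^-1` V) UU.
by have [b [bV]] := acl (~` V) V VC aV.
Qed.

Lemma bounded_ccvg z B : (forall t, normc (z t) <= B) -> exists c, ccvg z c.
Proof.
move=> zB.
have [a za] : exists a : R, (fun t => complex.Re (z t)) @ U --> a.
  apply: (real_bounded_cvg (B := B)) => t; apply: le_trans (zB t).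
  by rewrite normcE -sqrtr_sqr ler_wsqrtr // lerDl sqr_ge0.
have [b zb] : exists b : R, (fun t => complex.Im (z t)) @ U --> b.
  apply: (real_bounded_cvg (B := B)) => t; apply: le_trans (zB t).
  by rewrite normcE -sqrtr_sqr ler_wsqrtr // lerDr sqr_ge0.
by exists (a +i* b)%C.
Qed.

Lemma squeeze_ccvg0 z (x : T -> R) :
  (\forall t \near U, normc (z t) <= x t) -> x @ U --> (0 : R) -> ccvg z 0.
Proof.
move=> zx x0.
have bound (y : T -> R) : (forall t, `|y t| <= normc (z t)) -> y @ U --> (0 : R).
  move=> yz; apply/cvgr0Pnorm_lt => e e0.
  have /cvgr0Pnorm_lt /(_ _ e0) xe := x0.
  apply: filterS2 zx xe => t zxt xet.
  by apply: le_lt_trans (yz t) (le_lt_trans zxt (le_lt_trans (ler_norm _) xet)).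
split; apply: bound => t; rewrite normcE -sqrtr_sqr ler_wsqrtr //.
  by rewrite lerDl sqr_ge0.
by rewrite lerDr sqr_ge0.
Qed.

End Limits.

Section PolyLimits.
Variables (R : realType) (l : nat) (T : Type) (U : set_system T).
Context {UU : UltraFilter U}.
Implicit Types (G H : T -> cpoly R l) (g h p : cpoly R l) (z : T -> R[i]).

Notation normc := ComplexField.Normc.normc.

Definition pcvg G h : Prop :=
  forall m, ccvg U (fun t => mcoeff m (G t)) (mcoeff m h).

Lemma pcvg_cst h : pcvg (fun _ => h) h.
Proof. by move=> m; apply: ccvg_cst. Qed.

Lemma pcvg_near G H h : (\forall t \near U, G t = H t) -> pcvg G h -> pcvg H h.
Proof.
by move=> GH Gh m; apply: ccvg_near (Gh m); apply: filterS GH => t ->.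
Qed.

Lemma pcvgD G H g h : pcvg G g -> pcvg H h -> pcvg (fun t => G t + H t) (g + h).
Proof.
move=> Gg Hh m; rewrite mcoeffD; under eq_fun do rewrite mcoeffD.
exact: ccvgD.
Qed.

Lemma pcvgM G H g h : pcvg G g -> pcvg H h -> pcvg (fun t => G t * H t) (g * h).
Proof.
move=> Gg Hh m; rewrite mcoeffM; under eq_fun do rewrite mcoeffM.
by apply: ccvg_sum => k; apply: ccvgM.
Qed.

Lemma pcvgZ z c G h : ccvg U z c -> pcvg G h -> pcvg (fun t => z t *: G t) (c *: h).
Proof.
move=> zc Gh m; rewrite mcoeffZ; under eq_fun do rewrite mcoeffZ.
exact: ccvgM.
Qed.

Lemma pcvgX G h k : pcvg G h -> pcvg (fun t => G t ^+ k) (h ^+ k).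
Proof.
move=> Gh; elim: k => [|k IH]; first exact: pcvg_cst.
by rewrite exprS; under eq_fun do rewrite exprS; apply: pcvgM.
Qed.

Lemma pcvg_prod (I : Type) (s : seq I) (P : pred I) (G : I -> T -> cpoly R l)
    (h : I -> cpoly R l) :
  (forall i, pcvg (G i) (h i)) ->
  pcvg (fun t => \prod_(i <- s | P i) G i t) (\prod_(i <- s | P i) h i).
Proof.
move=> Gh; elim: s => [|i s IH].
  by rewrite big_nil; under eq_fun do rewrite big_nil; apply: pcvg_cst.
rewrite big_cons; under eq_fun do rewrite big_cons.
by case: (P i) => //; apply: pcvgM.
Qed.

Lemma pcvg_unique G g h : pcvg G g -> pcvg G h -> g = h.
Proof. by move=> Gg Gh; apply/mpolyP => m; apply: ccvg_unique (Gg m) (Gh m). Qed.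

Lemma pcvg_coef0 G h m : pcvg G h -> (forall t, mcoeff m (G t) = 0) -> mcoeff m h = 0.
Proof.
move=> Gh G0; apply: ccvg_unique (Gh m) _.
by under eq_fun do rewrite G0; apply: ccvg_cst.
Qed.

Lemma pcvg_multideg_le G h (d : multinom l) i :
  pcvg G h -> (forall t, (multideg (G t) i <= d i)%N) -> (multideg h i <= d i)%N.
Proof.
move=> Gh Gd; apply: multideg_le => m; apply: contraNT => md.
apply/eqP; apply: pcvg_coef0 Gh _ => t; apply/eqP; apply: contraNT md => mt.
exact: leq_trans (coef_le_multideg i mt) (Gd t).
Qed.

(** A fixed box of monomials, instead of the support, lets limits pass through
    the sum. *)
Definition l1norm (b : nat) p : R := \sum_(m : bmultinom l b) normc (mcoeff m p).

Lemma l1norm_ge0 b p : 0 <= l1norm b p.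
Proof. by rewrite sumr_ge0 // => m _; apply: normc_ge0. Qed.

Lemma msupp_bmultinom b p : (msize p <= b)%N ->
  {subset msupp p <= [seq (m : multinom l) | m : bmultinom l b]}.
Proof.
move=> pb m mp; have mb : (mdeg m < b)%N := leq_trans (msize_mdeg_lt mp) pb.
by apply/mapP; exists (BMultinom mb); rewrite ?mem_enum.
Qed.

Lemma pnorm_le_l1norm b p : (msize p <= b)%N -> pnorm p <= l1norm b p.
Proof.
move=> pb; apply: le_trans (pnorm_le_sum _ (msupp_bmultinom pb)) _.
  by rewrite map_inj_uniq ?enum_uniq //; apply: val_inj.
by rewrite big_map big_enum.
Qed.

(** Compactness of the unit sphere of a finite family of polynomials of bounded
    degree: the scaled coefficients are bounded by 1, hence converge, and their
    total norm remains 1 in the limit. *)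
Lemma pcvg_normalized (J : finType) (b : nat) (G : J -> T -> cpoly R l) :
  let s t := \sum_j l1norm b (G j t) in
  (forall j t, (msize (G j t) <= b)%N) -> (\forall t \near U, s t != 0) ->
  exists h : J -> cpoly R l,
    (forall j, pcvg (fun t => ((s t)^-1)%:C%C *: G j t) (h j)) /\
    exists j, h j != 0.
Proof.
move=> s Gb s0.
pose z j m t : R[i] := ((s t)^-1)%:C%C * mcoeff m (G j t).
have s_ge0 t : 0 <= s t by apply: sumr_ge0 => j _; apply: l1norm_ge0.
have normcZ t j m : normc (z j m t) = (s t)^-1 * normc (mcoeff m (G j t)).
  rewrite ComplexField.Normc.normcM; congr (_ * _).
  by rewrite /= expr0n /= addr0 sqrtr_sqr ger0_norm // invr_ge0.
have zcvg j (m : bmultinom l b) : exists c, ccvg U (z j m) c.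
  apply: (bounded_ccvg (B := 1)) => t; rewrite normcZ.
  have [->|st0] := eqVneq (s t) 0; first by rewrite invr0 mul0r.
  rewrite mulrC ler_pdivrMr ?lt0r ?st0 ?s_ge0 // mul1r.
  rewrite /s (bigD1 j) //= {1}/l1norm (bigD1 m) //= -addrA lerDl.
  by rewrite addr_ge0 ?sumr_ge0 // => ? _; rewrite ?normc_ge0 ?l1norm_ge0.
pose c j m := projT1 (cid (zcvg j m)).
have zc j (m : bmultinom l b) : ccvg U (z j m) (c j m) := projT2 (cid (zcvg j m)).
pose h j : cpoly R l := \sum_(m : bmultinom l b) c j m *: mpolyX _ (m : multinom l).
have hE j (m : bmultinom l b) : mcoeff m (h j) = c j m.
  rewrite raddf_sum (bigD1 m) //= mcoeffZ mcoeffX eqxx mulr1 big1 ?addr0 // => k km.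
  by rewrite mcoeffZ mcoeffX -[_ == _]/(k == m) (negPf km) mulr0.
have hE0 j m : (b <= mdeg m)%N -> mcoeff m (h j) = 0.
  move=> bm; rewrite raddf_sum big1 // => k _ /=; rewrite mcoeffZ mcoeffX.
  case: eqP => [km|_]; last by rewrite mulr0.
  by have := bmdeg k; rewrite km ltnNge bm.
exists h; split.
  move=> j m; under eq_fun do rewrite mcoeffZ.
  have [mb|mb] := ltnP (mdeg m) b.
    by have := zc j (BMultinom mb); rewrite -hE.
  rewrite hE0 //; apply: ccvg_near (ccvg_cst 0).
  near=> t; rewrite memN_msupp_eq0 ?mulr0 //; apply: msize_mdeg_ge.
  exact: leq_trans (Gb j t) mb.
apply: contrapT => none.
have h0 j : h j = 0 by apply/eqP; apply: contrapT => /negP hj; apply: none; exists j.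
have sum1 : (fun t => \sum_j \sum_(m : bmultinom l b) normc (z j m t)) @ U --> (0 : R).
  rewrite [X in _ --> X](_ : _ = \sum_(j : J) \sum_(m : bmultinom l b) (0 : R)); last first.
    by rewrite big1 // => j _; rewrite big1.
  apply: cvg_big => [|j _]; first exact: add_continuous.
  apply: cvg_big => [|m _]; first exact: add_continuous.
  have zn : (fun t => normc (z j m t)) @ U --> normc (c j m).
    by apply: ccvg_normc; apply: zc.
  by rewrite -hE h0 mcoeff0 ComplexField.Normc.normc0 in zn.
have sum1E : \forall t \near U, \sum_j \sum_(m : bmultinom l b) normc (z j m t) = 1.
  apply: filterS s0 => t st0; rewrite -(mulVf st0) /s mulr_sumr.
  by apply: eq_bigr => j _; rewrite mulr_sumr; apply: eq_bigr => m _; apply: normcZ.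
have : (1 : R) = 0.
  by apply: (cvg_unique _ _ sum1) => //; apply: cvg_near_cst.
by apply/eqP; rewrite oner_eq0.
Unshelve. all: try by end_near.
Qed.

End PolyLimits.

Section MonicCoefficient.
Variables (R : realType) (l : nat) (T : Type) (U : set_system T).
Context {UU : UltraFilter U}.
Implicit Types (G : T -> cpoly R l).

(** On the unit sphere there is a nonzero limit; a coefficient at which it does
    not vanish may then be scaled to 1. *)
Lemma pcvg_unit_coef (G : T -> cpoly R l) b :
  (forall t, (msize (G t) <= b)%N) -> (forall t, G t != 0) ->
  exists mu h, [/\ mcoeff mu h = 1, \forall t \near U, mcoeff mu (G t) != 0
    & pcvg U (fun t => (mcoeff mu (G t))^-1 *: G t) h].
Proof.
move=> Gb G0; pose s t := \sum_(j : unit) l1norm b (G t).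
have s_gt0 t : 0 < s t.
  rewrite /s big_const card_unit /= addr0.
  exact: lt_le_trans (pnorm_gt0 (G0 t)) (pnorm_le_l1norm (Gb t)).
have [||h [hlim [[] h0]]] := @pcvg_normalized R l T U _ unit b (fun _ => G).
- by move=> _ t; apply: Gb.
- by apply: filterS filterT => t _; rewrite gt_eqF // s_gt0.
set h1 := h tt in h0; have {}hlim := hlim tt.
pose mu := mlead h1; pose a t : R[i] := ((s t)^-1)%:C%C.
have a0 t : a t != 0 by rewrite fmorph_eq0 invr_eq0 gt_eqF.
have x0 : mcoeff mu h1 != 0 by rewrite -mcoeff_msupp mlead_supp.
have xlim : ccvg U (fun t => mcoeff mu (a t *: G t)) (mcoeff mu h1) by apply: hlim.
exists mu, ((mcoeff mu h1)^-1 *: h1); split.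
- by rewrite mcoeffZ mulVf.
- apply: filterS (ccvg_neq0 x0 xlim) => t.
  by rewrite mcoeffZ mulf_eq0 negb_or => /andP[].
- apply: pcvg_near (pcvgZ (ccvgV x0 xlim) hlim).
  apply: filterS filterT => t _; rewrite mcoeffZ scalerA invfM.
  by rewrite mulrAC mulVf ?mul1r.
Qed.

End MonicCoefficient.

(** * The product rule *)

Section Differences.
Variables (R : realType) (l : nat) (T : Type) (U : set_system T).
Context {UU : UltraFilter U}.
Variable s : T -> R[i].
Implicit Types (G H : T -> cpoly R l) (g h e : cpoly R l).

(** With s the inverse of a quantity that tends to 0, the limit e is a
    derivative of G at its limit h. *)
Definition pdiff G h e : Prop :=
  pcvg U G h /\ pcvg U (fun t => s t *: (G t - h)) e.

Lemma pdiff1 : pdiff (fun _ => 1) 1 0.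
Proof.
split; first exact: pcvg_cst.
by under eq_fun do rewrite subrr scaler0; apply: pcvg_cst.
Qed.

Lemma pdiffM G H g h e e' :
  pdiff G g e -> pdiff H h e' -> pdiff (fun t => G t * H t) (g * h) (e * h + g * e').
Proof.
move=> [Gg Ge] [Hh He]; split; first exact: pcvgM.
have -> : (fun t => s t *: (G t * H t - g * h)) =
    (fun t => s t *: (G t - g) * H t + g * (s t *: (H t - h))).
  by apply/funext => t; rewrite -!mul_mpolyC; ring.
by apply: pcvgD; apply: pcvgM => //; apply: pcvg_cst.
Qed.

Lemma pdiffX G h e k :
  pdiff G h e -> pdiff (fun t => G t ^+ k.+1) (h ^+ k.+1) ((h ^+ k * e) *+ k.+1).
Proof.
move=> Gh; elim: k => [|k IH]; first by rewrite expr0 mul1r mulr1n.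
have -> : (fun t => G t ^+ k.+2) = (fun t => G t * G t ^+ k.+1).
  by apply/funext => t; rewrite exprS.
have -> : (h ^+ k.+1 * e) *+ k.+2 = e * h ^+ k.+1 + h * ((h ^+ k * e) *+ k.+1).
  by rewrite mulrnAr mulrA -exprS mulrS [e * _]mulrC.
by rewrite [h ^+ k.+2]exprS; apply: pdiffM.
Qed.

Lemma pdiff_prod (I : Type) (r : seq I) (P : pred I) (G : I -> T -> cpoly R l)
    (h : I -> cpoly R l) :
  (forall i, exists e, pdiff (G i) (h i) e) ->
  exists e, pdiff (fun t => \prod_(i <- r | P i) G i t) (\prod_(i <- r | P i) h i) e.
Proof.
move=> Gh; elim: r => [|i r [e IH]].
  exists 0; rewrite big_nil; under [X in pdiff X]eq_fun do rewrite big_nil.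
  exact: pdiff1.
have [e' Gi] := Gh i.
have -> : (fun t => \prod_(j <- i :: r | P j) G j t) =
    (fun t => if P i then G i t * \prod_(j <- r | P j) G j t
              else \prod_(j <- r | P j) G j t).
  by apply/funext => t; rewrite big_cons.
rewrite big_cons; case: (P i); last by exists e.
by eexists; apply: pdiffM Gi IH.
Qed.

Lemma pdiff_unique G h e e' : pdiff G h e -> pdiff G h e' -> e = e'.
Proof. by move=> [_ Ge] [_ Ge']; apply: pcvg_unique Ge Ge'. Qed.

End Differences.

(** * Rigidity of factorizations at first order *)

Section Rigidity.
Variables (R : realType) (l r : nat) (T : Type) (U : set_system T).
Context {UU : UltraFilter U}.
Variables (k : 'I_r -> nat) (mu : 'I_r -> multinom l).
Variables (h : 'I_r -> cpoly R l) (G : 'I_r -> T -> cpoly R l).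
Variables (f : cpoly R l) (g : T -> cpoly R l) (c : R[i]) (beta : T -> R[i]).
Hypothesis k_gt0 : forall j, (0 < k j)%N.
Hypothesis h_prime : forall j, prime_elt (h j).
Hypothesis h_distinct : forall i j, i != j -> ~ associated (h i) (h j).
Hypothesis h_coef : forall j, mcoeff (mu j) (h j) = 1.
Hypothesis G_coef : forall j, \forall t \near U, mcoeff (mu j) (G j t) = 1.
Hypothesis c_neq0 : c != 0.
Hypothesis fE : f = c *: \prod_j h j ^+ k j.
Hypothesis gE : \forall t \near U, g t = beta t *: \prod_j G j t ^+ k j.

Lemma limit_factor_neq0 j : h j != 0.
Proof. by case: (h_prime j). Qed.

(** The scalar has a derivative gam, because it can be recovered from one
    coefficient of the product; the product rule then says that g stays still at
    first order. *)
Lemma scalar_diff s e :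
  (forall j, pdiff U s (G j) (h j) (e j)) ->
  pcvg U (fun t => s t *: (g t - f)) 0 ->
  exists gam, forall E,
    pdiff U s (fun t => \prod_j G j t ^+ k j) (\prod_j h j ^+ k j) E ->
    gam *: \prod_j h j ^+ k j + c *: E = 0.
Proof.
move=> Ge g0; pose P t := \prod_j G j t ^+ k j; pose H := \prod_j h j ^+ k j.
rewrite -/H -/P; have [E PE] : exists E, pdiff U s P H E.
  apply: pdiff_prod => j; have := pdiffX (k j).-1 (Ge j).
  by rewrite prednK // => Gj; eexists; apply: Gj.
have H0 : H != 0 by apply/prodf_neq0 => j _; rewrite expf_neq0 ?limit_factor_neq0.
pose nu := mlead H.
have nu0 : mcoeff nu H != 0 by rewrite -mcoeff_msupp mlead_supp.
have [Plim Pdiff] := PE.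
have splitE : \forall t \near U,
    s t *: (g t - f) = (s t * (beta t - c)) *: P t + c *: (s t *: (P t - H)).
  apply: filterS gE => t ->; rewrite fE -/H -/(P t) -!mul_mpolyC rmorphM rmorphB /=.
  ring.
pose gam := (mcoeff nu 0 - c * mcoeff nu E) / mcoeff nu H.
have gam_lim : ccvg U (fun t => s t * (beta t - c)) gam.
  apply: ccvg_near (ccvgM (ccvgB (g0 nu) (ccvgM (ccvg_cst c) (Pdiff nu)))
                          (ccvgV nu0 (Plim nu))).
  apply: filterS2 splitE (ccvg_neq0 nu0 (Plim nu)) => t -> Pt0.
  by rewrite mcoeffD !mcoeffZ addrK mulfK.
exists gam => E' PE'; have -> : E' = E := pdiff_unique PE' PE.
apply: (pcvg_unique (U := U) _ g0).
apply: pcvg_near (pcvgD (pcvgZ gam_lim Plim) (pcvgZ (ccvg_cst c) Pdiff)).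
by apply: filterS splitE => t ->.
Qed.

(** The tangent equation shows that h j divides the variation e j of G j; as
    the degree of e j is at most that of h j, e j is a constant multiple of h j,
    and the constant vanishes because the coefficient of G j at mu j does not move. *)
Lemma factors_rigid s e :
  (forall j, pdiff U s (G j) (h j) (e j)) ->
  (forall j i, (multideg (e j) i <= multideg (h j) i)%N) ->
  pcvg U (fun t => s t *: (g t - f)) 0 ->
  forall j, e j = 0.
Proof.
move=> Ge edeg g0 j.
have [gam tangent] := scalar_diff Ge g0.
have [EQ QE] : exists E, pdiff U s (fun t => \prod_(i | i != j) G i t ^+ k i)
                               (\prod_(i | i != j) h i ^+ k i) E.
  apply: pdiff_prod => i; have := pdiffX (k i).-1 (Ge i).
  by rewrite prednK // => Gi; eexists; apply: Gi.
set Q := \prod_(i | _) _ in QE.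
have kE : k j = (k j).-1.+1 by rewrite prednK.
have pQ : ~ divides (h j) Q.
  move=> /(prime_divides_bigprod (h_prime j))[i ij /(prime_dividesX (h_prime j))].
  move=> /(prime_divides_prime (h_prime j) (h_prime i)).
  by apply: h_distinct; rewrite eq_sym.
have ck : mpolyC l c *+ (k j).-1.+1 \is a GRing.unit.
  rewrite -rmorphMn; apply: rmorph_unit.
  by rewrite unitfE mulrn_eq0 negb_or c_neq0.
have dvd : divides (h j) (e j).
  apply: (prime_divides_tangent (h_prime j) pQ ck (gam := mpolyC l gam) (E := EQ)).
  have PE := pdiffM (pdiffX (k j).-1 (Ge j)) QE.
  rewrite -kE in PE *.
  have Gj : (fun t => \prod_i G i t ^+ k i) =
      (fun t => G j t ^+ k j * \prod_(i | i != j) G i t ^+ k i).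
    by apply/funext => t; rewrite (bigD1 j).
  have hj : \prod_i h i ^+ k i = h j ^+ k j * Q by rewrite (bigD1 j).
  rewrite Gj hj in tangent; have := tangent _ (PE _ _).
  by rewrite -!mul_mpolyC; apply.
have [w eE] := dvd; have [//|e0] := eqVneq (e j) 0.
have w0 : w != 0 by apply: contraNneq e0 => w0; rewrite eE w0 mul0r.
have /(msize1_polyC)wE : (msize w <= 1)%N.
  have -> : 1%N = (mdeg (@mnm0 l)).+1 by rewrite mdeg0.
  apply: msize_le_multideg => i.
  have := edeg j i; rewrite eE multidegM ?limit_factor_neq0 // mnmDE mnm0E.
  by rewrite -[X in (_ <= X)%N -> _]add0n leq_add2r.
have ecoef : mcoeff (mu j) (e j) = 0.
  have [_ /(_ (mu j)) elim] := Ge j.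
  apply: ccvg_unique elim _; apply: ccvg_near (ccvg_cst 0).
  by apply: filterS (G_coef j) => t Gt; rewrite mcoeffZ mcoeffB Gt h_coef subrr mulr0.
move: ecoef; rewrite eE wE mul_mpolyC mcoeffZ h_coef mulr1 => wc0.
by rewrite wc0 scale0r.
Qed.

(** Otherwise g would move infinitely less than the factors, and the factors,
    rescaled by their total variation, would have a nonzero variation e that
    does not move the product at first order. *)
Lemma factors_lipschitz :
  (forall j, pcvg U (G j) (h j)) ->
  (forall j t i, (multideg (G j t) i <= multideg (h j) i)%N) ->
  exists C, 0 < C /\
    \forall t \near U, forall j, pnorm (h j - G j t) <= C * pnorm (g t - f).
Proof.
move=> Gh Gdeg; apply: contrapT => none.
pose b := \max_j (mdeg (multideg (h j))).+1.
have dsize j t : (msize (G j t - h j) <= b)%N.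
  apply: leq_trans (leq_bigmax j); apply: msize_le_multideg => i.
  exact: multidegB_le (Gdeg j t i) (leqnn _).
pose D t := \sum_j l1norm b (G j t - h j).
have DC C : 0 < C -> \forall t \near U, C * pnorm (g t - f) < D t.
  move=> C0; have [small|] := in_ultra_setVsetC [set t | D t <= C * pnorm (g t - f)] UU.
    case: none; exists C; split=> //; apply: filterS small => t /= Dt j.
    apply: le_trans Dt; rewrite pnormBC; apply: le_trans (pnorm_le_l1norm (dsize j t)) _.
    by rewrite /D (bigD1 j) //= lerDl sumr_ge0 // => i _; apply: l1norm_ge0.
  by apply: filterS => t /= /negP; rewrite -ltNge.
have D0 : \forall t \near U, D t != 0.
  apply: filterS (DC 1 ltr01) => t; rewrite mul1r => /(le_lt_trans (pnorm_ge0 _)).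
  by move=> Dt; rewrite gt_eqF.
have [e [elim [j0 ej0]]] := pcvg_normalized dsize D0.
case/negP: ej0; apply/eqP.
apply: (@factors_rigid (fun t => ((D t)^-1)%:C%C) e); first by move=> j; split.
- move=> j i; apply: pcvg_multideg_le (elim j) _ => t.
  apply: multideg_le => m; rewrite mcoeffZ mulf_eq0 negb_or => /andP[_ Gm].
  exact: leq_trans (coef_le_multideg i Gm) (multidegB_le (Gdeg j t i) (leqnn _)).
- move=> m; rewrite mcoeff0.
  apply: (squeeze_ccvg0 (x := fun t => (D t)^-1 * pnorm (g t - f))).
    apply: filterS filterT => t _; rewrite mcoeffZ ComplexField.Normc.normcM.
    have D_ge0 : 0 <= D t by rewrite sumr_ge0 // => j _; apply: l1norm_ge0.
    rewrite [X in X * _](_ : _ = (D t)^-1); last first.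
      by rewrite /= expr0n /= addr0 sqrtr_sqr ger0_norm // invr_ge0.
    by rewrite ler_wpM2l ?invr_ge0 // normc_le_pnorm.
  apply/cvgr0Pnorm_lt => eps eps0.
  have inv0 : 0 < eps^-1 by rewrite invr_gt0.
  apply: filterS (DC _ inv0) => t DCt.
  have Dt : 0 < D t by apply: le_lt_trans DCt; rewrite mulr_ge0 ?pnorm_ge0 // ltW.
  rewrite ger0_norm ?mulr_ge0 ?invr_ge0 ?pnorm_ge0 ?ltW //.
  by rewrite mulrC ltr_pdivrMr // -ltr_pdivrMl.
Qed.

End Rigidity.

(** * Indexing the factors on a factorization manifold *)

Section ManifoldFamily.
Variables (R : realType) (l : nat).
Implicit Types (p q : cpoly R l) (fs : power_product R l) (M : structure l).

Lemma pcoprime_not_associated p q : irreducible p -> pcoprime p q -> ~ associated p q.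
Proof.
move=> [_ /negP pU _] pq [u uU pE]; apply: pU.
rewrite pE unitrM uU; apply: (pq q u 1) => //; by rewrite mul1r.
Qed.

(** Coprimality is stated on indices; as an irreducible polynomial is not
    coprime to itself, the entries are distinct and it is a property of pairs
    of members, whatever their order. *)
Lemma perm_irreducible_coprime fs fs' :
  perm_eq fs fs' -> irreducible_coprime fs -> irreducible_coprime fs'.
Proof.
move=> pfs [fsI fsC]; split=> [fk|i j i_lt j_lt ij].
  by rewrite -(perm_mem pfs); apply: fsI.
have ufs : uniq fs.
  apply/(uniqP (0, 0%N)) => i' j'; rewrite !inE => i'_lt j'_lt eqij.
  apply/eqP/negP => /negP i'j'; have := fsC _ _ i'_lt j'_lt i'j'; rewrite eqij.
  move=> /pcoprime_not_associated; apply; last exact: associated_refl.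
  by apply: fsI; apply: mem_nth.
have ufs' : uniq fs' by rewrite -(perm_uniq pfs).
set x := nth _ fs' i; set y := nth _ fs' j.
have xfs : x \in fs by rewrite (perm_mem pfs) mem_nth.
have yfs : y \in fs by rewrite (perm_mem pfs) mem_nth.
rewrite -(nth_index (0, 0%N) xfs) -(nth_index (0, 0%N) yfs).
apply: fsC; rewrite ?index_mem //.
apply: contraNneq ij => xyE.
rewrite -(nth_uniq (0, 0%N) i_lt j_lt ufs') -/x -/y.
by rewrite -(nth_index (0, 0%N) xfs) xyE nth_index.
Qed.

(** Indexing all members of the manifold by the entries of M gives their
    factors common degrees and exponents. *)
Lemma manifold_family M p : factorization_manifold M p ->
  exists (a : R[i]) (G : 'I_(size M) -> cpoly R l),
    [/\ p = a *: \prod_j G j ^+ (nth (mnm0, 0%N) M j).2,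
        forall j, multideg (G j) = (nth (mnm0, 0%N) M j).1,
        forall j, irreducible (G j)
      & forall i j, i != j -> ~ associated (G i) (G j)].
Proof.
move=> [_ [a [gs [sgs gsIC pE]]]].
have [gs' pgs' gs'E] := perm_map_inv sgs.
have [gsI gsC] : irreducible_coprime gs'.
  by apply: perm_irreducible_coprime gsIC; rewrite perm_sym.
have sz : size gs' = size M by rewrite -gs'E size_map.
have nthM (j : 'I_(size M)) : nth (mnm0, 0%N) M j =
    (multideg (nth (0, 0%N) gs' j).1, (nth (0, 0%N) gs' j).2).
  by rewrite -{1}gs'E (nth_map (0, 0%N)) // sz.
have in_gs' (j : 'I_(size M)) : nth (0, 0%N) gs' j \in gs' by rewrite mem_nth ?sz.
exists a, (fun j => (nth (0, 0%N) gs' j).1); split.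
- rewrite pE; congr (_ *: _); rewrite /expand -(perm_big _ pgs') (big_nth (0, 0%N)) sz.
  by rewrite big_mkord; apply: eq_bigr => j _; rewrite nthM.
- by move=> j; rewrite nthM.
- by move=> j; apply: gsI; apply: in_gs'.
- move=> i j ij; apply: pcoprime_not_associated; first by apply: gsI; apply: in_gs'.
  by apply: gsC; rewrite ?sz ?ltn_ord.
Qed.

End ManifoldFamily.

(** * Limits of factorizations *)

Section LimitFactorization.
Variables (R : realType) (l r : nat) (T : Type) (U : set_system T).
Context {UU : UltraFilter U}.
Variables (k : 'I_r -> nat) (d : 'I_r -> multinom l).
Variables (f : cpoly R l) (alpha : R[i]) (F : 'I_r -> cpoly R l).
Variables (g : T -> cpoly R l) (beta : T -> R[i]) (G : 'I_r -> T -> cpoly R l).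
Hypothesis k_gt0 : forall j, (0 < k j)%N.
Hypothesis f_neq0 : f != 0.
Hypothesis f_deg : forall i, multideg f i = (\sum_j d j i * k j)%N.
Hypothesis fE : f = alpha *: \prod_j F j ^+ k j.
Hypothesis F_irr : forall j, irreducible (F j).
Hypothesis F_distinct : forall i j, i != j -> ~ associated (F i) (F j).
Hypothesis gE : forall t, g t = beta t *: \prod_j G j t ^+ k j.
Hypothesis G_irr : forall j t, irreducible (G j t).
Hypothesis G_deg : forall j t, multideg (G j t) = d j.
Hypothesis g_lim : pcvg U g f.

(** The factors of g t, suitably scaled, converge to polynomials h j with the
    same product as f up to a constant.  Since the degrees add up to that of f,
    no h j is constant, and counting irreducible factors shows that the h j are
    those of f.  Rigidity at the limit then gives the Lipschitz bound. *)
Lemma limit_lipschitz :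
  exists (h : 'I_r -> cpoly R l) (C : R),
    [/\ matched (@associated _) (repeat_family k F) (repeat_family k h),
        forall j, h j != 0, 0 < C
      & \forall t \near U, forall j, exists2 a : R[i], a != 0
          & pnorm (h j - a *: G j t) <= C * pnorm (g t - f)].
Proof.
have G0 j t : G j t != 0 by case: (G_irr j t).
have unit_coef j : exists mu h, [/\ mcoeff mu h = 1,
    \forall t \near U, mcoeff mu (G j t) != 0
  & pcvg U (fun t => (mcoeff mu (G j t))^-1 *: G j t) h].
  apply: (pcvg_unit_coef (b := (mdeg (d j)).+1)) => t; last exact: G0.
  by apply: msize_le_multideg => i; rewrite G_deg.
have [mu /choice[h muh]] := choice unit_coef.
pose x j t := mcoeff (mu j) (G j t).
pose G' j t := (x j t)^-1 *: G j t.
have h1 j : mcoeff (mu j) (h j) = 1 by case: (muh j).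
have G'h j : pcvg U (G' j) (h j) by case: (muh j).
have x0 : \forall t \near U, forall j, x j t != 0.
  by apply: filter_forall => j; case: (muh j).
have h0 j : h j != 0.
  by apply: contraTneq (oner_neq0 R[i]) => hj; rewrite -(h1 j) hj mcoeff0 eqxx.
pose beta' t := beta t * \prod_j x j t ^+ k j.
have gE' : \forall t \near U, g t = beta' t *: \prod_j G' j t ^+ k j.
  apply: filterS x0 => t xt; rewrite gE.
  have -> : \prod_j G j t ^+ k j = \prod_j x j t ^+ k j *: \prod_j G' j t ^+ k j.
    rewrite -mul_mpolyC rmorph_prod -big_split; apply: eq_bigr => j _ /=.
    by rewrite rmorphXn /= -exprMn mul_mpolyC scalerA divff // scale1r.
  by rewrite scalerA.
pose H := \prod_j h j ^+ k j.
have G'H : pcvg U (fun t => \prod_j G' j t ^+ k j) H.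
  by apply: pcvg_prod => j; apply: pcvgX.
have H0 : H != 0 by apply/prodf_neq0 => j _; rewrite expf_neq0.
have nu0 : mcoeff (mlead H) H != 0 by rewrite -mcoeff_msupp mlead_supp.
pose c := mcoeff (mlead H) f / mcoeff (mlead H) H.
have beta_lim : ccvg U beta' c.
  apply: ccvg_near (ccvgM (g_lim (mlead H)) (ccvgV nu0 (G'H (mlead H)))).
  apply: filterS2 gE' (ccvg_neq0 nu0 (G'H (mlead H))) => t -> Ht.
  by rewrite mcoeffZ mulfK.
have fH : f = c *: H.
  apply: (pcvg_unique (U := U) g_lim); apply: pcvg_near (pcvgZ beta_lim G'H).
  by apply: filterS gE' => t ->.
have c0 : c != 0 by apply: contraNneq f_neq0 => c0; rewrite fH c0 scale0r.
have G'deg j t i : (multideg (G' j t) i <= d j i)%N.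
  rewrite -(G_deg j t); have [xt|xt] := eqVneq (x j t) 0.
    by rewrite /G' xt invr0 scale0r; apply: multideg_le => m; rewrite mcoeff0 eqxx.
  by rewrite /G' multidegZ ?invr_eq0.
(* no degree is lost in the limit, because none is lost in the product *)
have hdeg j : multideg (h j) = d j.
  have hle j' i : (multideg (h j') i <= d j' i)%N.
    exact: pcvg_multideg_le (G'h j') (fun t => G'deg j' t i).
  apply/mnmP => i; apply/eqP; rewrite eqn_leq hle /= leqNgt; apply/negP => lt.
  have : multideg f i = (\sum_j multideg (h j) i * k j)%N.
    rewrite fH multidegZ // multideg_prod => [|j']; last by rewrite expf_neq0.
    by apply: eq_bigr => j' _; rewrite multidegX // mulmnE.
  rewrite f_deg => /eqP; rewrite gtn_eqF // (bigD1 j) //= [X in (_ < X)%N](bigD1 j) //=.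
  rewrite -addSn leq_add ?ltn_mul2r ?k_gt0 //.
  by apply: leq_sum => j' _; rewrite leq_mul2r hle orbT.
have hU j : h j \isn't a GRing.unit.
  have [t _] := filter_ex (filterT : U setT).
  by rewrite unit_multideg // hdeg -(G_deg j t) -unit_multideg //; case: (G_irr j t).
have alpha0 : alpha != 0.
  by apply: contraNneq f_neq0 => a0; rewrite fE a0 scale0r.
have [|||||mat hP hd] := @family_matched _ r k F h (mpolyC l (c / alpha)) k_gt0.
- by apply: rmorph_unit; rewrite unitfE mulf_neq0 ?invr_eq0.
- by move=> j; apply: mpoly_irreducible_prime; apply: F_irr.
- exact: F_distinct.
- exact: hU.
- rewrite -/H mul_mpolyC mulrC -scalerA -fH fE scalerA mulVf ?scale1r //.
have [||C [C0 lip]] := factors_lipschitz k_gt0 hP hd h1 _ c0 fH gE' G'h.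
- by move=> j; apply: filterS x0 => t xt; rewrite mcoeffZ mulVf.
- by move=> j t i; rewrite hdeg.
exists h, C; split=> //.
apply: filterS2 x0 lip => t xt lipt j; exists (x j t)^-1; last exact: lipt.
by rewrite invr_eq0.
Qed.

End LimitFactorization.

(** * Comparing two factorizations *)

Section Assembly.
Variables (R : realType) (l : nat).
Implicit Types (p q f g : cpoly R l) (fs gs : power_product R l) (M : structure l).

(** Unique factorization: the constants only contribute units. *)
Lemma irreducible_factors_matched (ps qs : seq (cpoly R l)) (a b : R[i]) :
  a != 0 -> b != 0 -> (forall p, p \in ps -> irreducible p) ->
  (forall q, q \in qs -> irreducible q) ->
  a *: \prod_(p <- ps) p = b *: \prod_(q <- qs) q ->
  matched (@associated _) ps qs.
Proof.
move=> a0 b0 psI qsI prodE.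
apply: (@unique_factorization _ _ _ (mpolyC l (b / a))).
- by apply: rmorph_unit; rewrite unitfE mulf_neq0 ?invr_eq0.
- by move=> p /psI; apply: mpoly_irreducible_prime.
- by move=> q /qsI; apply: mpoly_irreducible_prime.
- by rewrite mul_mpolyC mulrC -scalerA -prodE scalerA mulVf ?scale1r.
Qed.

Lemma isf_repeat_factors f (a : R[i]) fs : irreducible_squarefree_factorization f a fs ->
  [/\ a != 0, f = a *: \prod_(p <- repeat_factors fs) p
    & forall p, p \in repeat_factors fs -> irreducible p].
Proof.
move=> [a0 _ [fsI _] ->]; split=> //; first by rewrite prod_repeat_factors.
by move=> p /mem_repeat_factors[fk /fsI fkI ->].
Qed.

Lemma associated_scale p q : associated p q ->
  exists2 a : R[i], a != 0 & p = a *: q.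
Proof.
case=> u uU ->; have u1 : msize u = 1%N by apply/eqP; rewrite -mpoly_unit_msize.
have uE := msize1_polyC (eq_leq u1); exists (mcoeff mnm0 u).
  by apply: contraTneq uU => u0; rewrite uE u0 mpolyC0 unitr0.
by rewrite {1}uE mul_mpolyC.
Qed.

Lemma factorization_structure_gt0 M (j : 'I_(size M)) :
  is_factorization_structure R M -> (0 < (nth (mnm0, 0%N) M j).2)%N.
Proof.
move=> [f [a [fs [[_ k0 _ _] pM]]]].
have : nth (mnm0, 0%N) M j \in structure_of fs by rewrite (perm_mem pM) mem_nth.
by case/mapP => fk /k0 ? ->.
Qed.

Lemma multideg_structure M f i : factorization_manifold M f ->
  multideg f i = (\sum_(j < size M)
     (nth (mnm0, 0%N) M j).1 i * (nth (mnm0, 0%N) M j).2)%N.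
Proof.
move=> [[_ ->] _]; rewrite /structure_degree mnm_sumE (big_nth (mnm0, 0%N)) big_mkord.
by apply: eq_bigr => j _; rewrite mulmnE.
Qed.

(** The sine of two factors only depends on the lines that they span, so the
    scalars are harmless; it is relative to the norm of h j, hence the sum of
    the inverses of these norms. *)
Lemma dist_le_factors r (k : 'I_r -> nat) (ps qs : seq (cpoly R l)) (a b : R[i])
    (h G : 'I_r -> cpoly R l) C e :
  (forall j, h j != 0) -> (forall j, G j != 0) -> 0 <= C -> 0 <= e ->
  matched (@associated _) ps (repeat_family k h) ->
  matched (@associated _) (repeat_family k G) qs ->
  (forall j, exists2 c : R[i], c != 0 & pnorm (h j - c *: G j) <= C * e) ->
  dist (a, ps) (b, qs) <= (C * \sum_j (pnorm (h j))^-1) * e.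
Proof.
move=> h0 G0 C0 e0 psh Gqs close.
have hV j : 0 <= (pnorm (h j))^-1 by rewrite invr_ge0 pnorm_ge0.
apply: dist_le; first by rewrite !mulr_ge0 ?sumr_ge0.
have hG : matched (fun x y => exists j, x = h j /\ y = G j)
    (repeat_family k h) (repeat_family k G).
  by apply: matched_repeat_family => j; exists j.
apply: matched_sub (matched_trans psh (matched_trans hG Gqs)) => p q _ _.
move=> [x /associated_scale[u u0 pE] [y [j [xE yE]]]].
move=> /associated_sym/associated_scale[v v0 qE]; subst x y.
have [c c0 hc] := close j.
have cG0 : c *: G j != 0 by rewrite scaler_eq0 negb_or c0 G0.
apply: le_trans (psin_le_proportional (u := u) (v := v / c) (h0 j) cG0 u0 _ pE _) _.
- by rewrite mulf_neq0 ?invr_eq0.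
- by rewrite scalerA divfK.
rewrite ler_pdivrMr ?pnorm_gt0 //; apply: le_trans hc _.
set S := \sum_j _.
have nS : 1 <= S * pnorm (h j).
  rewrite /S (bigD1 j) //= mulrDl mulVf ?gt_eqF ?pnorm_gt0 // lerDl.
  by rewrite mulr_ge0 ?pnorm_ge0 // sumr_ge0.
have -> : C * S * e * pnorm (h j) = (C * e) * (S * pnorm (h j)) by ring.
by rewrite ler_peMr ?mulr_ge0.
Qed.

End Assembly.

Theorem corollary3p8 (R : realType) (l : nat) (M : structure l)
    (hM : is_factorization_structure R M)
    (f : cpoly R l) (hf : factorization_manifold M f)
    (alpha : complex R) (fs : power_product R l)
    (hfs : irreducible_squarefree_factorization f alpha fs) :
  exists delta eta : R,
    [/\ 0 < delta, 0 < eta &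
      forall g : cpoly R l, factorization_manifold M g ->
        pnorm (f - g) < delta ->
        forall (beta : complex R) (gs : power_product R l),
          irreducible_squarefree_factorization g beta gs ->
          dist (flat_factorization alpha fs) (flat_factorization beta gs)
            <= eta * pnorm (f - g)].
Proof.
apply: contrapT => none.
have bad (n : nat) : exists x : cpoly R l * R[i] * power_product R l,
    [/\ factorization_manifold M x.1.1, pnorm (f - x.1.1) < n.+1%:R^-1,
        irreducible_squarefree_factorization x.1.1 x.1.2 x.2
      & n.+1%:R * pnorm (f - x.1.1) <
        dist (flat_factorization alpha fs) (flat_factorization x.1.2 x.2)].
  apply: contrapT => nox; apply: none; exists n.+1%:R^-1, n.+1%:R.
  split; rewrite ?invr_gt0 ?ltr0n // => g gM fg beta gs ggs.
  rewrite leNgt; apply/negP => lt; apply: nox; by exists (g, beta, gs).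
have [x xP] := choice bad; pose g n := (x n).1.1.
have gM n : factorization_manifold M (g n) by case: (xP n).
have [a [F [fE Fdeg Firr Fdist]]] := manifold_family hf.
have /choice[b /choice[G GP]] n := manifold_family (gM n).
pose k (j : 'I_(size M)) := (nth (mnm0, 0%N) M j).2.
have k_gt0 j : (0 < k j)%N by apply: factorization_structure_gt0 hM.
have [U [UU Uoo]] := ultraFilterLemma eventually_filter.
have nearU (P : set nat) : (\forall n \near \oo, P n) -> \forall n \near U, P n.
  exact: Uoo.
have g_lim : pcvg U g f.
  move=> m; suff : ccvg U (fun n => mcoeff m (f - g n)) 0.
    move=> /(ccvgB (ccvg_cst (mcoeff m f))); rewrite subr0.
    by under eq_fun do rewrite mcoeffB subKr.
  apply: (squeeze_ccvg0 (x := fun n => n.+1%:R^-1)).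
    apply: filterS filterT => n _; apply: le_trans (normc_le_pnorm _ _) _.
    by rewrite ltW //; case: (xP n).
  by move=> V V0; apply: nearU; apply: (@cvg_harmonic R).
have f0 : f != 0 by case: hf => -[].
have [|||h [C [Fh h0 C0 lip]]] := limit_lipschitz k_gt0 f0
    (fun i => multideg_structure i hf) fE Firr Fdist (G := fun j n => G n j)
    (beta := b) _ _ _ g_lim.
- by move=> n; case: (GP n).
- by move=> j n; case: (GP n).
- by move=> j n; case: (GP n).
have [alpha0 fsE fsI] := isf_repeat_factors hfs.
have a0 : a != 0 by apply: contraNneq f0 => a0; rewrite fE a0 scale0r.
have fsF : matched (@associated _) (repeat_factors fs) (repeat_family k F).
  apply: (irreducible_factors_matched alpha0 a0 fsI).
    by move=> q /mem_repeat_family[j ->].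
  by rewrite prod_repeat_family -fsE -fE.
have fsh : matched (@associated _) (repeat_factors fs) (repeat_family k h).
  apply: matched_sub (matched_trans fsF Fh) => p q _ _ [y].
  exact: associated_trans.
pose C' := C * \sum_j (pnorm (h j))^-1.
have dist_small : \forall n \near U, forall j, exists2 c : R[i], c != 0 &
    pnorm (h j - c *: G n j) <= C * pnorm (f - g n).
  apply: filterS lip => n lipn j; have [c c0 hc] := lipn j.
  by exists c => //; rewrite pnormBC.
have large : \forall n \near U, C' <= n%:R by apply: nearU; apply: nbhs_infty_ger.
have [n [close Cn]] := filter_ex (filterI dist_small large).
have [_ _ gsn] := xP n; rewrite ltNge => /negP; apply.
have [b0 gsE gsI] := isf_repeat_factors gsn.
have [gE _ Girr _] := GP n.
have gn0 : g n != 0 by case: (gM n) => -[].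
have bn0 : b n != 0 by apply: contraNneq gn0 => b0'; rewrite gE b0' scale0r.
have Ggs : matched (@associated _) (repeat_family k (G n)) (repeat_factors (x n).2).
  apply: (irreducible_factors_matched bn0 b0 _ gsI).
    by move=> q /mem_repeat_family[j ->].
  by rewrite prod_repeat_family -gsE -gE.
have G0 j : G n j != 0 by case: (Girr j).
apply: le_trans (dist_le_factors alpha (x n).1.2 h0 G0 (ltW C0) (pnorm_ge0 _) fsh Ggs close) _.
rewrite ler_wpM2r ?pnorm_ge0 //; apply: le_trans Cn _.
by rewrite ler_nat leqnSn.
Qed.
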